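(* Let $d=1$. Then for all $\kappa\in\mathbb{N}^*$, $$\boldsymbol{\mu}_{A_\kappa}(\Delta)=[-1,1]\setminus\{\pm\cos(\pi j/\kappa):\ j=0,\ldots,\lfloor\kappa/2\rfloor\}.$$ In particular, $\Delta$ has $\kappa+1$ thresholds with respect to $A_\kappa$, where the thresholds are the elements of $\sigma_{\mathrm{ess}}(\Delta)\setminus\boldsymbol{\mu}_{A_\kappa}(\Delta)$.
   Context: $\mathbb{N}^*$ denotes the positive integers. On $\ell^2(\mathbb{Z})$, $(Su)(n)=u(n-1)$, $\Delta=\frac12(S+S^{-1})$ (spectrum $[-1,1]$), $(Nu)(n)=nu(n)$. $A_\kappa$ is the self-adjoint closure, from finitely supported sequences, of $\frac{1}{4\mathrm{i}}[(S^\kappa-S^{-\kappa})N+N(S^\kappa-S^{-\kappa})]$. $[\Delta,\mathrm{i}A_\kappa]_\circ$ is the bounded extension of the commutator form. $\boldsymbol{\mu}^\pm_{A_\kappa}(\Delta)$ is the set of $E\in\sigma(\Delta)$ for which there are an open interval $I\ni E$ and $\gamma>0$ with $\pm E_I(\Delta)[\Delta,\mathrm{i}A_\kappa]_\circ E_I(\Delta)\ge\gamma E_I(\Delta)$, where $E_I(\Delta)$ is the spectral projection, and $\boldsymbol{\mu}_{A_\kappa}(\Delta)=\boldsymbol{\mu}^+_{A_\kappa}(\Delta)\cup\boldsymbol{\mu}^-_{A_\kappa}(\Delta)$. *)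

(* Defs.v *)
From HB Require Import structures.
From mathcomp Require Import all_boot all_order all_algebra.
From mathcomp Require Import all_classical all_reals all_analysis.
From mathcomp Require Import complex.

Set Implicit Arguments.
Unset Strict Implicit.
Unset Printing Implicit Defensive.

Import Order.TTheory GRing.Theory Num.Theory.
Import numFieldNormedType.Exports.

Local Open Scope classical_set_scope.
Local Open Scope ring_scope.
Local Open Scope complex_scope.

(* Vectors are two-sided complex sequences; membership in the Hilbert space
   l^2(Z) is the predicate [l2].  A bounded operator is a map on all sequences
   of which only the restriction to [l2] matters; a possibly unbounded operator
   is represented by its graph. *)
Definition seqZ (R : realType) : Type := int -> R[i].
Definition oper (R : realType) : Type := seqZ R -> seqZ R.
Definition graph (R : realType) : Type := seqZ R -> seqZ R -> Prop.

(* All series over Z below converge absolutely (for arguments in l^2), so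
   symmetric partial sums give the unconditional sum. *)
Definition psumZ (R : realType) (f : int -> R) : nat -> R :=
  fun n => \sum_(k < n.*2.+1) f (k%:Z - n%:Z).

Definition sumZ (R : realType) (f : int -> R) : R := limn (psumZ f).

Definition sqmod (R : realType) (z : R[i]) : R :=
  complex.Re z ^+ 2 + complex.Im z ^+ 2.

Definition l2 (R : realType) (u : seqZ R) : Prop :=
  cvgn (psumZ (fun n => sqmod (u n))).

Definition normsq (R : realType) (u : seqZ R) : R :=
  sumZ (fun n => sqmod (u n)).

(* Antilinear in the first argument. *)
Definition inner (R : realType) (u v : seqZ R) : R[i] :=
  sumZ (fun n => complex.Re ((u n)^*%C * v n)) +i*
  sumZ (fun n => complex.Im ((u n)^*%C * v n)).

Definition bounded_op (R : realType) (T : oper R) : Prop :=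
  [/\ forall u, l2 u -> l2 (T u),
      forall (a : R[i]) u v, l2 u -> l2 v ->
        T (fun n => a * u n + v n) = (fun n => a * T u n + T v n) &
      exists M : R, forall u, l2 u -> normsq (T u) <= M * normsq u].

Definition resolvent_at (R : realType) (T : oper R) (x : R) : Prop :=
  exists B : oper R, bounded_op B /\
    forall u, l2 u -> B (fun n => T u n - x%:C * u n) = u /\
                      (fun n => T (B u) n - x%:C * B u n) = u.

(* Real points only: for a self-adjoint operator this is the whole spectrum. *)
Definition spectrum (R : realType) (T : oper R) : set R :=
  [set x | ~ resolvent_at T x].

Definition in_eigenspace (R : realType) (T : oper R) (x : R) (u : seqZ R) : Prop :=
  l2 u /\ T u = (fun n => x%:C * u n).

Definition discrete_spectrum (R : realType) (T : oper R) : set R :=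
  [set x | [/\ isolated (spectrum T) x,
    (exists2 u, in_eigenspace T x u & u <> (fun=> 0)) &
    exists (d : nat) (e : 'I_d -> seqZ R), forall u, in_eigenspace T x u ->
      exists c : 'I_d -> R[i], u = (fun n => \sum_(i < d) c i * e i n)]].

Definition ess_spectrum (R : realType) (T : oper R) : set R :=
  spectrum T `\` discrete_spectrum T.

Definition orth_projection (R : realType) (P : oper R) : Prop :=
  [/\ bounded_op P,
      forall u, l2 u -> P (P u) = P u &
      forall u v, l2 u -> l2 v -> inner (P u) v = inner u (P v)].

(* The projection-valued measure of a bounded self-adjoint T: projections
   indexed by Borel sets, with bounded support (so E(R) = 1), multiplicative,
   countably additive, and T = \int x dE(x).  The last two properties are
   expressed through the diagonal measures <u, E(.) u>; by polarization, and
   since the E(B) are projections, this gives strong countable additivity. *)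
Definition spectral_measure_of (R : realType) (T : oper R)
    (E : set R -> oper R) : Prop :=
  [/\ forall B, measurable (B : set (measurableTypeR R)) ->
        orth_projection (E B),
      exists M : R, forall u, l2 u -> E `[- M, M]%classic u = u,
      forall B B', measurable (B : set (measurableTypeR R)) ->
        measurable (B' : set (measurableTypeR R)) ->
        forall u, l2 u -> E (B `&` B') u = E B (E B' u) &
      forall u, l2 u ->
        exists mu : {finite_measure set (measurableTypeR R) -> \bar R},
        [/\ forall B, measurable B -> mu B = (complex.Re (inner u (E B u)))%:E,
            mu.-integrable setT (fun x => (x : R)%:E) &
            inner u (T u) = (\int[mu]_x x)%:C]].

Definition spectral_projection (R : realType) (T : oper R) (B : set R) : oper R :=
  xget (fun _ _ _ => 0 : R[i])
    [set E : set R -> seqZ R -> seqZ R | spectral_measure_of T E] B.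

(* [T, iA] as a form on D(A):
   <u, [T, iA] v> = <T u, iA v> - <(iA)^* u, T v> = i (<T u, A v> - <A u, T v>),
   for T and A self-adjoint. *)
Definition commutator_extension (R : realType) (T : oper R) (A : graph R)
    (C : oper R) : Prop :=
  bounded_op C /\
  forall u Au v Av, A u Au -> A v Av ->
    inner u (C v) = 'i%C * (inner (T u) Av - inner Au (T v)).

Definition commutator (R : realType) (T : oper R) (A : graph R) : oper R :=
  xget (fun _ _ => 0 : R[i])
    [set C : seqZ R -> seqZ R | commutator_extension T A C].

(* [s] is the sign.  The order on R[i] is the one for which z <= w means that
   w - z is real and nonnegative, so that the inequality between quadratic
   forms is the operator inequality. *)
Definition mu_sgn (R : realType) (s : R[i]) (T : oper R) (A : graph R) : set R :=
  [set x | spectrum T x /\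
    exists (I : set R) (gamma : R),
      [/\ open I, is_interval I, I x, 0 < gamma &
          let P := spectral_projection T I in
          forall u, l2 u ->
            gamma%:C * inner u (P u) <= s * inner u (P (commutator T A (P u)))]].

Definition mu_plus (R : realType) (T : oper R) (A : graph R) := mu_sgn 1 T A.
Definition mu_minus (R : realType) (T : oper R) (A : graph R) := mu_sgn (- 1) T A.

Definition mu_set (R : realType) (T : oper R) (A : graph R) : set R :=
  mu_plus T A `|` mu_minus T A.

Definition thresholds (R : realType) (T : oper R) (A : graph R) : set R :=
  ess_spectrum T `\` mu_set T A.

(* S^k *)
Definition shiftZ (R : realType) (k : int) : oper R := fun u n => u (n - k).
Arguments shiftZ R k : clear implicits.

Definition Delta (R : realType) : oper R :=
  fun u n => 2%:R^-1 * (shiftZ R 1 u n + shiftZ R (- 1) u n).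

Definition position (R : realType) : oper R := fun u n => n%:~R * u n.

(* S^kappa - S^-kappa *)
Definition dshift (R : realType) (kappa : nat) : oper R :=
  fun u n => shiftZ R kappa%:Z u n - shiftZ R (- kappa%:Z) u n.

Definition A_formal (R : realType) (kappa : nat) : oper R :=
  fun u n => (4%:R * 'i%C)^-1 *
    (dshift kappa (position u) n + position (dshift kappa u) n).

Definition finsupp (R : realType) (u : seqZ R) : Prop :=
  finite_set [set n | u n <> 0].

(* Closure of the graph of [A_formal] restricted to finitely supported
   sequences; it is the graph of a self-adjoint operator. *)
Definition A_kappa (R : realType) (kappa : nat) : graph R :=
  fun u w => [/\ l2 u, l2 w &
    exists us : nat -> seqZ R,
      [/\ forall k, finsupp (us k),
          (fun k => normsq (fun n => us k n - u n)) @ \oo --> (0 : R) &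
          (fun k => normsq (fun n => A_formal kappa (us k) n - w n)) @ \oo
            --> (0 : R)]].

(* Main.v *)
Require Import Defs.
From HB Require Import structures.
From mathcomp Require Import all_boot all_order all_algebra.
From mathcomp Require Import all_classical all_reals all_analysis.
From mathcomp Require Import complex.
From mathcomp Require Import measurable_realfun ring lra zify.

(** Under the Fourier transform the Laplacian is multiplication by [cos t], and
    the commutator with [A_kappa] is multiplication by [sin t * sin (kappa t)],
    which is a polynomial [p] in [cos t]; so the commutator is [p(Delta)]
    ([comm_formal], [comm_poly], [commutatorE]).  At a point [x] of the spectrum
    with [p(x) <> 0] the commutator is close to the nonzero number [p(x)] on the
    spectral subspace of a short interval about [x], and the Mourre estimate
    holds with the sign of [p(x)] ([mu_in]).  At a zero of [p] the commutator is
    arbitrarily small on the nonzero spectral subspaces of short intervals, and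
    the estimate fails for both signs ([mu_out]).  The zeros of [p] in the
    spectrum are the [kappa + 1] points [cos (pi m / kappa)], for [m] from 0 to
    [kappa] ([comm_zero], [threshold_grid], [grid_inj]).

    Behind this are two pieces of spectral theory.  The first is a functional
    calculus that avoids the Fourier transform of square-summable sequences: a
    bounded Borel function [F] of the angle acts by the Laurent matrix of its
    cosine coefficients.  Its norm is at most the supremum of [F], because on
    finite sequences its form is an integral of [F] against a sum of squares
    ([dot_laurent_le]), and bounded pointwise convergence of symbols implies
    weak convergence ([laurent_weak_cvg]).  Products of symbols go to products
    of operators for polynomials in the cosine, by the product-to-sum formula,
    and then for indicators of Borel sets, by bounded pointwise limits
    ([mult_icos]).  Indicators composed with the cosine therefore define a
    projection-valued measure; that it represents the Laplacian is a statement
    on first moments, proved by halving intervals ([specmeas_moment],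
    [specproj_Delta]).  The same calculus provides the resolvent outside the
    interval from -1 to 1 and approximate eigenvectors inside it
    ([spectrum_Delta]).

    The second piece concerns an arbitrary spectral measure of a bounded
    symmetric operator [T], known only through first moments of the diagonal
    measures.  If [E I] annihilates [v] and fixes [w], the diagonal measure of
    [v + w] is the sum of those of [v] and [w], whence [v] is orthogonal to
    [T w].  This makes spectral subspaces invariant, bounds [T - x] on the
    subspace of an interval about [x] by its radius, and shows that this
    subspace is nonzero when [T - x] is not bounded below by the radius
    ([spectral_orth], [spectral_norm_le], [spectral_nonzero]). *)

Set Implicit Arguments.
Unset Strict Implicit.
Unset Printing Implicit Defensive.

Import Order.TTheory GRing.Theory Num.Theory.
Import numFieldNormedType.Exports.

Local Open Scope classical_set_scope.
Local Open Scope ring_scope.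

(** * Sums over symmetric windows of the integers *)

Section WindowSums.
Variable V : zmodType.
Implicit Types (f : int -> V) (N k : nat).

Definition wsum f N : V := \sum_(k < N.*2.+1) f (k%:Z - N%:Z).

Definition supp_in N f := forall n : int, (N < `|n|)%N -> f n = 0.

Lemma wsumS f N : wsum f N.+1 = wsum f N + f N.+1%:Z + f (- N.+1%:Z).
Proof.
rewrite /wsum doubleS big_ord_recr big_ord_recl /=.
have -> : f (0%:Z - N.+1%:Z) = f (- N.+1%:Z) by congr f; lia.
have -> : f ((N.*2.+2)%:Z - N.+1%:Z) = f N.+1%:Z by congr f; lia.
rewrite -addrA [LHS]addrC; congr (_ + _ + _).
by apply: eq_bigr => i _; congr f; rewrite /bump /=; lia.
Qed.

Lemma wsum_out f N K : supp_in N f -> (N <= K)%N -> wsum f K = wsum f N.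
Proof.
move=> f0; elim: K => [|K IH]; first by rewrite leqn0 => /eqP ->.
rewrite leq_eqVlt => /predU1P[->//|NK].
rewrite wsumS !f0 ?IH ?addr0 //; lia.
Qed.

Lemma wsum_shift1 f N : wsum (fun n => f (n + 1)) N = wsum f N + f N.+1%:Z - f (- N%:Z).
Proof.
elim: N => [|N IH].
  by rewrite /wsum !big_ord1 subr0 add0r oppr0 addrAC subrr add0r.
rewrite wsumS IH wsumS.
have -> : f (N.+1%:Z + 1) = f N.+2%:Z by congr f; lia.
have -> : f (- N.+1%:Z + 1) = f (- N%:Z) by congr f; lia.
by rewrite [RHS]addrAC addrK [LHS]addrAC subrK.
Qed.

Lemma supp_in_shift f N k : supp_in N f -> supp_in (N + k) (fun n => f (n + k%:Z)).
Proof. by move=> f0 n nN; apply: f0; lia. Qed.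

Lemma supp_in_shiftN f N k : supp_in N f -> supp_in (N + k) (fun n => f (n - k%:Z)).
Proof. by move=> f0 n nN; apply: f0; lia. Qed.

Lemma wsum_shift f N k K : supp_in N f -> (N + k <= K)%N ->
  wsum (fun n => f (n + k%:Z)) K = wsum f K.
Proof.
move=> f0; elim: k => [|k IH] NK; first by congr wsum; apply/funext => n; rewrite addr0.
rewrite -IH; last by lia.
have E : (fun n => f (n + k.+1%:Z)) = (fun n => (fun m => f (m + k%:Z)) (n + 1)).
  by apply/funext => n; congr f; lia.
rewrite E (wsum_shift1 (fun m => f (m + k%:Z))).
rewrite [f (K.+1%:Z + _)]f0 ?[f (- K%:Z + _)]f0 ?addr0 ?subr0 //; lia.
Qed.

Lemma wsum_shiftN f N k K : supp_in N f -> (N + k + k <= K)%N ->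
  wsum (fun n => f (n - k%:Z)) K = wsum f K.
Proof.
move=> f0 NK; rewrite -(wsum_shift (supp_in_shiftN f0) NK).
by congr wsum; apply/funext => n; rewrite addrK.
Qed.

End WindowSums.


(** * Real square-summable sequences on the integers *)

Section RealSequences.
Context {R : realType}.
Implicit Types (f g a b c : int -> R) (N K : nat) (n m : int) (M : R).

Lemma psumZD f g N : psumZ (fun n => f n + g n) N = psumZ f N + psumZ g N.
Proof. by rewrite /psumZ big_split. Qed.

Lemma psumZZ (k : R) f N : psumZ (fun n => k * f n) N = k * psumZ f N.
Proof. by rewrite /psumZ mulr_sumr. Qed.

Lemma psumZS f N :
  psumZ f N.+1 = psumZ f N + f N.+1%:Z + f (- N.+1%:Z).
Proof. exact: wsumS. Qed.

Lemma psumZ_ge0 f N : (forall n, 0 <= f n) -> 0 <= psumZ f N.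
Proof. by move=> f0; apply: sumr_ge0. Qed.

Lemma le_psumZ f g N : (forall n, f n <= g n) -> psumZ f N <= psumZ g N.
Proof. by move=> fg; apply: ler_sum. Qed.

Lemma eq_psumZ f g N : (forall n, f n = g n) -> psumZ f N = psumZ g N.
Proof. by move=> fg; apply: eq_bigr. Qed.

Lemma psumZ_nd f : (forall n, 0 <= f n) -> nondecreasing_seq (psumZ f).
Proof.
move=> f0; apply/nondecreasing_seqP => N; rewrite psumZS -addrA lerDl.
by rewrite addr_ge0.
Qed.

(** For nonnegative terms convergence of the symmetric partial sums is their
    boundedness, so every summability statement below reduces to a bound that is
    uniform in the window. *)
Lemma psumZ_cvg f M : (forall n, 0 <= f n) -> (forall N, psumZ f N <= M) ->
  cvgn (psumZ f).
Proof.
move=> f0 fM; apply: nondecreasing_is_cvgn; first exact: psumZ_nd.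
by exists M => _ [N _ <-].
Qed.

Lemma psumZ_le_sumZ f N : (forall n, 0 <= f n) -> cvgn (psumZ f) ->
  psumZ f N <= sumZ f.
Proof. by move=> f0 cf; apply: nondecreasing_cvgn_le => //; exact: psumZ_nd. Qed.

Lemma sumZ_le f M : cvgn (psumZ f) -> (forall N, psumZ f N <= M) -> sumZ f <= M.
Proof. by move=> cf fM; apply: limr_le => //; exact: nearW. Qed.

Lemma term_le_psumZ f n : (forall n, 0 <= f n) -> f n <= psumZ f `|n|%N.
Proof.
move=> f0; case nk: `|n|%N => [|k].
  have -> : n = 0 by lia.
  by rewrite /psumZ big_ord1 subr0.
have p0 := psumZ_ge0 k f0.
rewrite psumZS; have [->|->] : n = k.+1%:Z \/ n = - k.+1%:Z by lia.
  by have := f0 (- k.+1%:Z); lra.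
by have := f0 k.+1%:Z; lra.
Qed.

Definition l2R a := cvgn (psumZ (fun n => a n ^+ 2)).
Definition dot a b := sumZ (fun n => a n * b n).

Lemma l2R_bound a M : (forall N, psumZ (fun n => a n ^+ 2) N <= M) -> l2R a.
Proof. by apply: psumZ_cvg => n; exact: sqr_ge0. Qed.

Lemma l2R_psumZ_le a N : l2R a -> psumZ (fun n => a n ^+ 2) N <= dot a a.
Proof.
move=> la; rewrite /dot.
have -> : (fun n => a n * a n) = (fun n => a n ^+ 2) by apply/funext => n; rewrite expr2.
by apply: psumZ_le_sumZ => // n; exact: sqr_ge0.
Qed.

Lemma l2RD a b : l2R a -> l2R b -> l2R (fun n => a n + b n).
Proof.
move=> la lb; apply: (@l2R_bound _ (2 * dot a a + 2 * dot b b)) => N.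
apply: le_trans (_ : psumZ (fun n => 2 * a n ^+ 2 + 2 * b n ^+ 2) N <= _).
  by apply: le_psumZ => n; have := sqr_ge0 (a n - b n); nra.
rewrite psumZD !psumZZ.
by rewrite lerD // ler_wpM2l // l2R_psumZ_le.
Qed.

Lemma l2RZ (k : R) a : l2R a -> l2R (fun n => k * a n).
Proof.
move=> la; rewrite /l2R.
have -> : psumZ (fun n => (k * a n) ^+ 2) = (fun N => k ^+ 2 * psumZ (fun n => a n ^+ 2) N).
  by apply/funext => N; rewrite -psumZZ; apply: eq_psumZ => n; rewrite exprMn.
by apply: is_cvgMr.
Qed.
Arguments l2RZ k [a].

Lemma l2RB a b : l2R a -> l2R b -> l2R (fun n => a n - b n).
Proof.
move=> la lb; have := l2RD la (l2RZ (-1) lb).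
by congr l2R; apply/funext => n; rewrite mulN1r.
Qed.

Lemma l2R0 : l2R (fun=> 0).
Proof.
by apply: (@l2R_bound _ 0) => N; rewrite /psumZ big1// => i _; rewrite expr0n.
Qed.

Lemma dot_is_cvg a b : l2R a -> l2R b -> cvgn (psumZ (fun n => a n * b n)).
Proof.
move=> la lb.
have -> : psumZ (fun n => a n * b n) = (fun N => 4^-1 *
    (psumZ (fun n => (a n + b n) ^+ 2) N - psumZ (fun n => (a n - b n) ^+ 2) N)).
  apply/funext => N; rewrite -[X in _ - X]mul1r -mulNr -psumZZ -psumZD -psumZZ.
  by apply: eq_psumZ => n; field.
apply: is_cvgMr; apply: is_cvgB; first exact: l2RD.
exact: l2RB.
Qed.

Lemma dot_cvgn a b : l2R a -> l2R b -> psumZ (fun n => a n * b n) @ \oo --> dot a b.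
Proof. by move=> la lb; exact: dot_is_cvg. Qed.

Lemma dotC a b : dot a b = dot b a.
Proof. by rewrite /dot; congr sumZ; apply/funext => n; rewrite mulrC. Qed.

Lemma dotDl a b c : l2R a -> l2R b -> l2R c ->
  dot (fun n => a n + b n) c = dot a c + dot b c.
Proof.
move=> la lb lc; apply: cvg_lim => //.
have -> : psumZ (fun n => (a n + b n) * c n) =
    (fun N => psumZ (fun n => a n * c n) N + psumZ (fun n => b n * c n) N).
  by apply/funext => N; rewrite -psumZD; apply: eq_psumZ => n; rewrite mulrDl.
by apply: cvgD; exact: dot_cvgn.
Qed.

Lemma dotZl (k : R) a b : l2R a -> l2R b -> dot (fun n => k * a n) b = k * dot a b.
Proof.
move=> la lb; apply: cvg_lim => //.
have -> : psumZ (fun n => k * a n * b n) = (fun N => k * psumZ (fun n => a n * b n) N).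
  by apply/funext => N; rewrite -psumZZ; apply: eq_psumZ => n; rewrite mulrA.
by apply: cvgMr; exact: dot_cvgn.
Qed.
Arguments dotZl k [a b].

Lemma dotBl a b c : l2R a -> l2R b -> l2R c ->
  dot (fun n => a n - b n) c = dot a c - dot b c.
Proof.
move=> la lb lc; rewrite -mulN1r -dotZl // -dotDl //; last exact: l2RZ.
by congr dot; apply/funext => n; rewrite mulN1r.
Qed.

Lemma dotDr a b c : l2R a -> l2R b -> l2R c ->
  dot a (fun n => b n + c n) = dot a b + dot a c.
Proof. by move=> la lb lc; rewrite dotC dotDl // !(dotC a). Qed.

Lemma dotZr (k : R) a b : l2R a -> l2R b -> dot a (fun n => k * b n) = k * dot a b.
Proof. by move=> la lb; rewrite dotC dotZl // (dotC a). Qed.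
Arguments dotZr k [a b].

Lemma dotBr a b c : l2R a -> l2R b -> l2R c ->
  dot a (fun n => b n - c n) = dot a b - dot a c.
Proof. by move=> la lb lc; rewrite dotC dotBl // !(dotC a). Qed.

Lemma dot_ge0 a : l2R a -> 0 <= dot a a.
Proof.
move=> la; apply: le_trans (l2R_psumZ_le 0 la).
by apply: psumZ_ge0 => n; exact: sqr_ge0.
Qed.

Lemma term_le_dot a n : l2R a -> a n ^+ 2 <= dot a a.
Proof.
move=> la; apply: le_trans (l2R_psumZ_le `|n|%N la).
by apply: (@term_le_psumZ (fun n => a n ^+ 2)) => k; exact: sqr_ge0.
Qed.

Lemma dot0_eq0 a : l2R a -> dot a a <= 0 -> a = fun=> 0.
Proof.
move=> la a0; apply/funext => n; apply/eqP; rewrite -sqrf_eq0 eq_le sqr_ge0 andbT.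
exact: le_trans (term_le_dot n la) a0.
Qed.

(** The discriminant criterion in the form in which it follows from an
    inequality between arithmetic and geometric means with a free weight. *)
Lemma discr_le (X V U M : R) : 0 <= M -> 0 <= U -> 0 <= V ->
  (forall s, s * X <= M / 2 * (s ^+ 2 * V + U)) -> X ^+ 2 <= M ^+ 2 * V * U.
Proof.
move=> M0 U0 V0 H.
have [MV0|MV0] := eqVneq (M * V) 0.
  have H1 s : s * X <= M / 2 * U.
    have := H s; rewrite mulrDr [M / 2 * (_ * _)](_ : _ = s ^+ 2 / 2 * (M * V)); last by ring.
    by rewrite MV0 mulr0 add0r.
  have -> : X = 0.
    apply/eqP; apply: contraT => X0.
    have := H1 ((M / 2 * U + 1) / X); rewrite divfK // => ?; lra.
  by rewrite expr0n /= !mulr_ge0 // sqr_ge0.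
have MVp : 0 < M * V by rewrite lt_neqAle eq_sym MV0 mulr_ge0.
have := H (X / (M * V)).
have [M1 V1] : M != 0 /\ V != 0 by move: MV0; rewrite mulf_eq0 negb_or => /andP[].
have -> : X / (M * V) * X = X ^+ 2 / (M * V) by ring.
have -> : M / 2 * ((X / (M * V)) ^+ 2 * V + U) = X ^+ 2 / (M * V) / 2 + M * U / 2 by field; rewrite M1 V1.
move=> H1; have : X ^+ 2 / (M * V) <= M * U by lra.
by rewrite ler_pdivrMr // => H2; apply: le_trans H2 _; rewrite le_eqVlt; apply/orP; left; apply/eqP; ring.
Qed.

Lemma dot_CS a b : l2R a -> l2R b -> dot a b ^+ 2 <= dot a a * dot b b.
Proof.
move=> la lb; rewrite -[dot a a]mul1r -[1](expr1n _ 2).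
apply: discr_le => //; [exact: dot_ge0|exact: dot_ge0|] => s.
have lsa := l2RZ s la; have lc := l2RB lsa lb.
have := dot_ge0 lc.
rewrite (dotBl lsa lb lc) (dotBr lsa lsa lb) (dotBr lb lsa lb).
rewrite (dotZl _ la lsa) (dotZr _ la la) (dotZl _ la lb) (dotZr _ lb la).
rewrite (dotC b a); lra.
Qed.

(** Truncations are the finitely supported sequences on which identities are
    checked before passing to the limit. *)
Definition trunc N a : int -> R := fun n => if (`|n| <= N)%N then a n else 0.

Lemma psumZ_out f N K : (forall n, (N < `|n|)%N -> f n = 0) -> (N <= K)%N ->
  psumZ f K = psumZ f N.
Proof. exact: wsum_out. Qed.

Lemma psumZ_in f g N : (forall n, (`|n| <= N)%N -> f n = g n) -> psumZ f N = psumZ g N.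
Proof. by move=> fg; apply: eq_bigr => i _; apply: fg; have := ltn_ord i; lia. Qed.

Lemma sumZ_out f N : (forall n, (N < `|n|)%N -> f n = 0) -> psumZ f @ \oo --> psumZ f N.
Proof.
move=> f0; apply: cvg_near_cst; exists N => // K /= NK; exact: psumZ_out.
Qed.

Lemma psumZ_trunc N f g : psumZ (fun n => trunc N f n * g n) N = psumZ (fun n => f n * g n) N.
Proof. by apply: psumZ_in => n nN; rewrite /trunc nN. Qed.

Lemma l2R_fin a N : (forall n, (N < `|n|)%N -> a n = 0) -> l2R a.
Proof.
move=> a0; apply/cvg_ex; exists (psumZ (fun n => a n ^+ 2) N).
by apply: sumZ_out => n /a0 ->; rewrite expr0n.
Qed.

Lemma trunc_out N a n : (N < `|n|)%N -> trunc N a n = 0.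
Proof. by move=> nN; rewrite /trunc leqNgt nN. Qed.

Lemma l2R_trunc N a : l2R (trunc N a).
Proof. by apply: (@l2R_fin _ N) => n; exact: trunc_out. Qed.
Arguments l2R_trunc N a : clear implicits.

Lemma dot_fin N a b : (forall n, (N < `|n|)%N -> a n = 0) ->
  dot a b = psumZ (fun n => a n * b n) N.
Proof.
by move=> a0; apply: cvg_lim => //; apply: sumZ_out => n /a0 ->; rewrite mul0r.
Qed.

Lemma dot_trunc N a b : dot (trunc N a) b = psumZ (fun n => a n * b n) N.
Proof. by rewrite (@dot_fin N) ?psumZ_trunc // => n; exact: trunc_out. Qed.

Lemma trunc_cvg a : l2R a ->
  (fun N => dot (fun n => trunc N a n - a n) (fun n => trunc N a n - a n)) @ \oo --> (0 : R).
Proof.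
move=> la.
have -> : (fun N => dot (fun n => trunc N a n - a n) (fun n => trunc N a n - a n)) =
    (fun N => dot a a - psumZ (fun n => a n * a n) N).
  apply/funext => N; have lt := l2R_trunc N a.
  rewrite (dotBl lt la (l2RB lt la)) (dotBr lt lt la) (dotBr la lt la) (dotC a (trunc N a)).
  rewrite !dot_trunc.
  have -> : psumZ (fun n => a n * trunc N a n) N = psumZ (fun n => a n * a n) N.
    by apply: psumZ_in => n nN; rewrite /trunc nN.
  by lra.
rewrite -[X in _ --> X](subrr (dot a a)).
by apply: cvgB; [exact: cvg_cst|exact: dot_cvgn].
Qed.

Lemma sqr_cvg0 (x : R^nat) (y : R^nat) :
  (forall k, x k ^+ 2 <= y k) -> y @ \oo --> (0 : R) -> x @ \oo --> (0 : R).
Proof.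
move=> xy y0; apply/cvgrPdist_lt => e e0.
move/cvgrPdist_lt : y0 => /(_ _ (exprn_gt0 2 e0)).
apply: filterS => k; rewrite sub0r normrN => yk; rewrite sub0r normrN.
rewrite -(ltr_pXn2r (n := 2)) ?nnegrE ?normr_ge0 ?(ltW e0) //.
rewrite -normrX (ger0_norm (sqr_ge0 _)); apply: le_lt_trans (xy k) _.
exact: le_lt_trans (ler_norm _) yk.
Qed.

(** Joint continuity of the inner product: after expanding around the limits,
    each error term contains a factor that tends to zero and is controlled by
    the Cauchy-Schwarz inequality. *)
Lemma dot_cvg (x y : nat -> int -> R) a b :
  (forall k, l2R (x k)) -> (forall k, l2R (y k)) -> l2R a -> l2R b ->
  (fun k => dot (fun n => x k n - a n) (fun n => x k n - a n)) @ \oo --> (0 : R) ->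
  (fun k => dot (fun n => y k n - b n) (fun n => y k n - b n)) @ \oo --> (0 : R) ->
  (fun k => dot (x k) (y k)) @ \oo --> dot a b.
Proof.
move=> lx ly la lb xa yb.
have E k : dot (x k) (y k) =
    dot (fun n => x k n - a n) (fun n => y k n - b n) +
    dot (fun n => x k n - a n) b + dot a (fun n => y k n - b n) + dot a b.
  rewrite (dotBl (lx k) la (l2RB (ly k) lb)) (dotBl (lx k) la lb).
  rewrite (dotBr (lx k) (ly k) lb) (dotBr la (ly k) lb); lra.
rewrite (funext E).
pose dx k n := x k n - a n; pose dy k n := y k n - b n.
have ldx k : l2R (dx k) by exact: l2RB (lx k) la.
have ldy k : l2R (dy k) by exact: l2RB (ly k) lb.
rewrite -[X in _ --> X]add0r; apply: cvgD; last exact: cvg_cst.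
rewrite -[X in _ --> X]addr0; apply: cvgD; last first.
  apply: (@sqr_cvg0 _ (fun k => dot a a * dot (dy k) (dy k))).
    by move=> k; exact: dot_CS la (ldy k).
  by rewrite -(mulr0 (dot a a)); apply: cvgMr.
rewrite -[X in _ --> X]addr0; apply: cvgD; last first.
  apply: (@sqr_cvg0 _ (fun k => dot (dx k) (dx k) * dot b b)).
    by move=> k; exact: dot_CS (ldx k) lb.
  by rewrite -(mul0r (dot b b)); apply: cvgMl.
apply: (@sqr_cvg0 _ (fun k => dot (dx k) (dx k) * dot (dy k) (dy k))).
  by move=> k; exact: dot_CS (ldx k) (ldy k).
by rewrite -(mulr0 0); apply: cvgM.
Qed.

Definition delta m : int -> R := fun n => (n == m)%:R.

Lemma delta_out m n : (`|m| < `|n|)%N -> delta m n = 0.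
Proof. by rewrite /delta; case: eqP => // ->; rewrite ltnn. Qed.

Lemma l2R_delta m : l2R (delta m).
Proof. by apply: (@l2R_fin _ `|m|%N) => n; exact: delta_out. Qed.
Arguments l2R_delta m : clear implicits.

Lemma psumZ_delta m f N : psumZ (fun n => delta m n * f n) N = if (`|m| <= N)%N then f m else 0.
Proof.
elim: N => [|N IH].
  rewrite /psumZ big_ord1 /delta subr0 leqn0 absz_eq0 eq_sym.
  by case: eqP => [->|]; rewrite ?mul1r ?mul0r.
rewrite psumZS IH /delta.
have [-> | m1] := eqVneq m N.+1%:Z.
  have -> : (`|N.+1%:Z| <= N)%N = false by lia.
  have -> : (`|N.+1%:Z| <= N.+1)%N = true by lia.
  have -> : (- N.+1%:Z == N.+1%:Z) = false by lia.
  by rewrite /= mul1r mul0r add0r addr0.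
have [-> | m2] := eqVneq m (- N.+1%:Z).
  have -> : (`|- N.+1%:Z| <= N)%N = false by lia.
  have -> : (`|- N.+1%:Z| <= N.+1)%N = true by lia.
  by rewrite /= mul1r mul0r !add0r.
rewrite !mul0r !addr0.
by have -> : (`|m| <= N)%N = (`|m| <= N.+1)%N by lia.
Qed.

Lemma dot_delta m a : dot (delta m) a = a m.
Proof.
by rewrite (@dot_fin `|m|%N) ?psumZ_delta ?leqnn // => n; exact: delta_out.
Qed.

End RealSequences.

Arguments l2RZ {R} k [a] _.
Arguments dotZl {R} k [a b] _ _.
Arguments dotZr {R} k [a b] _ _.
Arguments l2R_trunc {R} N a.
Arguments l2R_delta {R} m.

(** * Bounded symbols and their averages over the half circle *)

Section BoundedSymbols.
Context {R : realType}.
Implicit Types (F G : R -> R) (M : R) (k : int).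

Definition bounded_by M F := forall x, `|F x| <= M.
(** The functions of the angle that serve as symbols. Boundedness on the whole
    line makes closure under sums and products unconditional. *)
Definition symbol F := measurable_fun setT F /\ exists M, bounded_by M F.

Lemma symbol_by M F : measurable_fun setT F -> bounded_by M F -> symbol F.
Proof. by move=> mF bF; split=> //; exists M. Qed.

Lemma symbol_cst (c : R) : symbol (fun=> c).
Proof. by apply: (@symbol_by `|c|) => // x. Qed.

Lemma symbolD F G : symbol F -> symbol G -> symbol (fun x => F x + G x).
Proof.
move=> [mF [M bF]] [mG [N bG]]; apply: (@symbol_by (M + N)).
  exact: measurable_funD.
by move=> x; apply: le_trans (ler_normD _ _) _; apply: lerD.
Qed.

Lemma symbolM F G : symbol F -> symbol G -> symbol (fun x => F x * G x).
Proof.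
move=> [mF [M bF]] [mG [N bG]]; apply: (@symbol_by (M * N)).
  exact: measurable_funM.
by move=> x; rewrite normrM; apply: ler_pM.
Qed.

Lemma symbolZ (c : R) F : symbol F -> symbol (fun x => c * F x).
Proof. exact: symbolM (symbol_cst c). Qed.

Lemma symbolB F G : symbol F -> symbol G -> symbol (fun x => F x - G x).
Proof.
move=> sF sG; have := symbolD sF (symbolZ (-1) sG).
by congr symbol; apply/funext => x; rewrite mulN1r.
Qed.

Lemma bounded_byM M N F G : bounded_by M F -> bounded_by N G ->
  bounded_by (M * N) (fun x => F x * G x).
Proof. by move=> bF bG x; rewrite normrM; apply: ler_pM. Qed.

Lemma bounded_by_ge0 M F : bounded_by M F -> 0 <= M.
Proof. by move=> bF; exact: le_trans (bF 0). Qed.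

Lemma symbol_continuous M F : continuous F -> bounded_by M F -> symbol F.
Proof. by move=> cF; apply: symbol_by; exact: continuous_measurable_fun. Qed.

Lemma continuous_cosM (c : R) : continuous (fun x : R => cos (c * x)).
Proof.
move=> x; apply: (@continuous_comp _ _ _ (fun x => c * x) cos); last exact: continuous_cos.
by apply: cvgMr; exact: cvg_id.
Qed.

Lemma continuous_sinM (c : R) : continuous (fun x : R => sin (c * x)).
Proof.
move=> x; apply: (@continuous_comp _ _ _ (fun x => c * x) sin); last exact: continuous_sin.
by apply: cvgMr; exact: cvg_id.
Qed.

Lemma symbol_cosM (c : R) : symbol (fun x => cos (c * x)).
Proof. by apply: (@symbol_continuous 1); [exact: continuous_cosM|move=> x; exact: cos_max]. Qed.

Lemma symbol_sinM (c : R) : symbol (fun x => sin (c * x)).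
Proof. by apply: (@symbol_continuous 1); [exact: continuous_sinM|move=> x; exact: sin_max]. Qed.

Lemma symbol_cos : symbol (@cos R).
Proof. by have := symbol_cosM 1; congr symbol; apply/funext => x; rewrite mul1r. Qed.

(** The symbol of the spectral projection of a Borel set: the Laplacian has
    symbol [cos]. *)
Definition icos (B : set R) : R -> R := fun x => \1_B (cos x).

Lemma icos_bounded B : bounded_by 1 (icos B).
Proof. by move=> x; rewrite /icos indicE; case: (_ \in _); rewrite ?normr1 ?normr0. Qed.

Lemma symbol_icos (B : set (measurableTypeR R)) : measurable B -> symbol (icos B).
Proof.
move=> mB; apply: (symbol_by _ (@icos_bounded B)).
apply: (@measurableT_comp _ _ _ _ _ _ (\1_B : measurableTypeR R -> R)).
  exact: measurable_indic.
by apply: continuous_measurable_fun; exact: continuous_cos.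
Qed.

Let mu := @lebesgue_measure R.
Let D := `[0, pi]%classic : set R.

Let muD : mu D = pi%:E.
Proof. by rewrite /mu /D lebesgue_measure_itv /= lte_fin pi_gt0 -EFinD subr0. Qed.

Let mD : measurable (D : set (measurableTypeR R)).
Proof. exact: measurable_itv. Qed.

(** The average over the half circle. A function of the cosine is an even
    function of the angle, so this is also its average over the circle, and its
    Fourier series has only cosine coefficients. *)
Definition avg F : R := pi^-1 * \int[mu]_(x in D) F x.

Lemma symbol_integrable F : symbol F -> mu.-integrable D (EFin \o F).
Proof.
move=> [mF [M bF]]; apply: measurable_bounded_integrable => //.
- by rewrite [X in (X < _)%E]muD ltry.
- exact: measurable_funS mF.
- by exists M; split; [exact: num_real|move=> N MN x _; exact: le_trans (bF x) (ltW MN)].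
Qed.

Lemma avgD F G : symbol F -> symbol G -> avg (fun x => F x + G x) = avg F + avg G.
Proof. by move=> sF sG; rewrite /avg RintegralD ?mulrDr //; exact: symbol_integrable. Qed.

Lemma avgZ (c : R) F : symbol F -> avg (fun x => c * F x) = c * avg F.
Proof. by move=> sF; rewrite /avg RintegralZl ?(mulrCA c) //; exact: symbol_integrable. Qed.

Lemma symbol_sum (I : Type) (r : seq I) (F : I -> R -> R) : (forall i, symbol (F i)) ->
  symbol (fun x => \sum_(i <- r) F i x).
Proof.
move=> sF; elim: r => [|i r IH].
  by under eq_fun do rewrite big_nil; exact: symbol_cst.
by under eq_fun do rewrite big_cons; exact: symbolD.
Qed.

Lemma avg_sum (I : Type) (r : seq I) (F : I -> R -> R) : (forall i, symbol (F i)) ->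
  avg (fun x => \sum_(i <- r) F i x) = \sum_(i <- r) avg (F i).
Proof.
move=> sF; elim: r => [|i r IH].
  rewrite big_nil; under eq_fun do rewrite big_nil.
  by rewrite /avg Rintegral_cst // mul0r mulr0.
rewrite big_cons -IH; under eq_fun do rewrite big_cons.
by rewrite avgD //; exact: symbol_sum.
Qed.

Lemma le_avg F G : symbol F -> symbol G -> (forall x, F x <= G x) -> avg F <= avg G.
Proof.
move=> sF sG FG; apply: ler_wpM2l; first by rewrite invr_ge0 pi_ge0.
by apply: le_Rintegral => //; exact: symbol_integrable.
Qed.

(** Dominated convergence; the constant [M] is the dominating function since the
    half circle has finite length. *)
Lemma avg_cvg M (F : nat -> R -> R) G :
  (forall n, symbol (F n)) -> (forall n, bounded_by M (F n)) -> symbol G ->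
  (forall x, F ^~ x @ \oo --> G x) -> avg \o F @ \oo --> avg G.
Proof.
move=> sF bF sG FG.
suff H : (fun n => \int[mu]_(x in D) F n x) @ \oo --> \int[mu]_(x in D) G x by exact: cvgMr H.
have iF n := symbol_integrable (sF n).
have iG := symbol_integrable sG.
have iM := symbol_integrable (symbol_cst M).
have [] := @dominated_convergence _ _ _ mu D mD (fun n => EFin \o F n) (EFin \o G)
  (EFin \o fun=> M).
- by move=> n; apply: measurable_int (iF n).
- by apply: measurable_int iG.
- by apply: aeW => x _; apply: cvg_EFin; [exact: nearW|exact: FG].
- exact: iM.
- by apply: aeW => x n _ /=; rewrite lee_fin; exact: bF.
move=> _ _ H; apply: fine_cvg; rewrite fineK; first exact: H.
exact: integrable_fin_num.
Qed.

Lemma sin_natpi n : sin (n%:R * pi) = 0 :> R.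
Proof.
elim: n => [|n IH]; first by rewrite mul0r sin0.
by rewrite -addn1 natrD mulrDl mul1r sinD IH sinpi mul0r mulr0 addr0.
Qed.

(** Orthonormality of the exponentials; it is the only explicit integral that is
    computed, with [sin (k x) / k] as a primitive. *)
Lemma avg_cos k : avg (fun x => cos (k%:~R * x)) = (k == 0)%:R.
Proof.
have [->|k0] := eqVneq k 0.
  rewrite /avg (@eq_Rintegral _ _ _ _ _ (fun=> 1)); last by move=> x _; rewrite mul0r cos0.
  by rewrite Rintegral_cst // [X in fine X]muD mul1r mulVf // gt_eqF // pi_gt0.
have kR : k%:~R != 0 :> R by rewrite intr_eq0.
pose S (x : R) := (k%:~R)^-1 * sin (k%:~R * x).
have dS x : is_derive (x : R) (1 : R) S (cos (k%:~R * x)).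
  rewrite /S; apply: is_derive_eq; rewrite /GRing.scale /= mulr1; field.
  exact: kR.
rewrite /avg /Rintegral (@continuous_FTC2 _ _ S).
- rewrite /= /S mulr0 sin0 mulr0 subr0.
  suff -> : sin (k%:~R * pi) = 0 :> R by rewrite !mulr0.
  case: (intP k) => [|n|n]; first by rewrite mul0r sin0.
    by rewrite sin_natpi.
  by rewrite mulrNz mulNr sinN sin_natpi oppr0.
- exact: pi_gt0.
- by apply: continuous_subspaceT; exact: continuous_cosM.
- have cS : continuous S.
    by move=> x; apply: differentiable_continuous; apply/derivable1_diffP; apply: ex_derive.
  split; first by move=> x _; apply: ex_derive.
    by apply: cvg_at_right_filter; exact: cS.
  by apply: cvg_at_left_filter; exact: cS.
- by move=> x _; rewrite derive1E; apply: derive_val.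
Qed.

End BoundedSymbols.

(** * Laurent operators *)

Section Convolution.
Context {R : realType}.
Implicit Types (F G : R -> R) (M : R) (k n m : int) (a b u v : int -> R) (N K : nat).

Definition coef F k : R := avg (fun x => F x * cos (k%:~R * x)).

Lemma coefN F k : coef F (- k) = coef F k.
Proof. by congr avg; apply/funext => x; rewrite mulrNz mulNr cosN. Qed.

Lemma coefB F n m : coef F (n - m) = coef F (m - n).
Proof. by rewrite -coefN opprB. Qed.

Lemma coef1 k : coef (fun=> 1) k = (k == 0)%:R.
Proof. by rewrite -avg_cos; congr avg; apply/funext => x; rewrite mul1r. Qed.

Lemma coefD F G k : symbol F -> symbol G ->
  coef (fun x => F x + G x) k = coef F k + coef G k.
Proof.
move=> sF sG; rewrite /coef -avgD; try by apply: symbolM => //; exact: symbol_cosM.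
by congr avg; apply/funext => x; rewrite mulrDl.
Qed.

Lemma coefZ (c : R) F k : symbol F -> coef (fun x => c * F x) k = c * coef F k.
Proof.
move=> sF; rewrite /coef -avgZ; last by apply: symbolM => //; exact: symbol_cosM.
by congr avg; apply/funext => x; rewrite mulrA.
Qed.

Let csum u N : R -> R := fun x => psumZ (fun n => u n * cos (n%:~R * x)) N.
Let ssum u N : R -> R := fun x => psumZ (fun n => u n * sin (n%:~R * x)) N.

Let symbol_csum u N : symbol (csum u N).
Proof. by apply: symbol_sum => i; apply: symbolZ; exact: symbol_cosM. Qed.

Let symbol_ssum u N : symbol (ssum u N).
Proof. by apply: symbol_sum => i; apply: symbolZ; exact: symbol_sinM. Qed.

Let qf F v u N K : R :=
  psumZ (fun n => psumZ (fun m => v n * coef F (n - m) * u m) K) N.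

(** The truncated quadratic form of the Laurent matrix is an integral against
    the symbol. Only cosines of differences occur, and the addition formula
    splits them into products, so real trigonometric polynomials suffice. *)
Let qfE F v u N K : symbol F ->
  qf F v u N K = avg (fun x => F x * (csum v N x * csum u K x + ssum v N x * ssum u K x)).
Proof.
move=> sF.
have sFc k : symbol (fun x => F x * cos (k%:~R * x)) by apply: symbolM => //; exact: symbol_cosM.
rewrite /qf /psumZ.
transitivity (\sum_(i < N.*2.+1) \sum_(j < K.*2.+1) avg (fun x =>
    (v (i%:Z - N%:Z) * u (j%:Z - K%:Z)) *
    (F x * cos ((i%:Z - N%:Z - (j%:Z - K%:Z))%:~R * x)))).
  apply: eq_bigr => i _; apply: eq_bigr => j _.
  by rewrite avgZ // /coef; ring.
transitivity (\sum_(i < N.*2.+1) avg (fun x => \sum_(j < K.*2.+1)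
    (v (i%:Z - N%:Z) * u (j%:Z - K%:Z)) *
    (F x * cos ((i%:Z - N%:Z - (j%:Z - K%:Z))%:~R * x)))).
  by apply: eq_bigr => i _; rewrite avg_sum // => j; exact: symbolZ.
rewrite -avg_sum; last by move=> i; apply: symbol_sum => j; exact: symbolZ.
congr avg; apply/funext => x.
rewrite /csum /ssum /psumZ !mulr_suml -big_split mulr_sumr.
apply: eq_bigr => i _ /=.
rewrite !mulr_sumr -big_split mulr_sumr; apply: eq_bigr => j _ /=.
by rewrite intrB mulrBl cosB; ring.
Qed.

Let qf1 u N : qf (fun=> 1) u u N N = psumZ (fun n => u n ^+ 2) N.
Proof.
apply: psumZ_in => n nN.
transitivity (psumZ (fun m => delta n m * (u n * u m)) N).
  apply: eq_psumZ => m; rewrite coef1 subr_eq0 /delta eq_sym; ring.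
by rewrite psumZ_delta nN expr2.
Qed.

(** With the constant symbol 1 the same formula is the Plancherel identity for
    trigonometric polynomials, which turns a pointwise bound on the symbol into
    a bound on the form. *)
Let qf_le F M v u N K : symbol F -> bounded_by M F ->
  qf F v u N K <= M / 2 * (psumZ (fun n => v n ^+ 2) N + psumZ (fun n => u n ^+ 2) K).
Proof.
move=> sF bF.
have sc := symbol_csum; have ss := symbol_ssum.
have s1 := symbol_cst (1 : R).
rewrite -2!qf1 !qfE //.
have sN w L : symbol (fun x => 1 * (csum w L x * csum w L x + ssum w L x * ssum w L x)).
  by apply: symbolZ; apply: symbolD; apply: symbolM.
rewrite -avgD // -avgZ; last exact: symbolD.
apply: le_avg.
- by apply: symbolM => //; apply: symbolD; apply: symbolM.
- by apply: symbolZ; apply: symbolD.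
move=> x; move: (csum v N x) (csum u K x) (ssum v N x) (ssum u K x) => vc uc vs us.
have M0 := bounded_by_ge0 bF.
apply: le_trans (ler_norm _) _; rewrite normrM.
apply: le_trans (ler_wpM2r (normr_ge0 _) (bF x)) _.
rewrite -mulrA; apply: ler_wpM2l => //.
rewrite ler_norml; apply/andP; split.
  by have := sqr_ge0 (vc + uc); have := sqr_ge0 (vs + us); lra.
by have := sqr_ge0 (vc - uc); have := sqr_ge0 (vs - us); lra.
Qed.

Let qf_CS F M v u N K : symbol F -> bounded_by M F ->
  (qf F v u N K) ^+ 2 <= M ^+ 2 * psumZ (fun n => v n ^+ 2) N * psumZ (fun n => u n ^+ 2) K.
Proof.
move=> sF bF; apply: discr_le.
- exact: bounded_by_ge0 bF.
- by apply: psumZ_ge0 => n; exact: sqr_ge0.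
- by apply: psumZ_ge0 => n; exact: sqr_ge0.
move=> s; have := qf_le (fun n => s * v n) u N K sF bF.
have -> : qf F (fun n => s * v n) u N K = s * qf F v u N K.
  rewrite /qf -psumZZ; apply: eq_psumZ => n; rewrite -psumZZ; apply: eq_psumZ => m; ring.
have -> // : psumZ (fun n => (s * v n) ^+ 2) N = s ^+ 2 * psumZ (fun n => v n ^+ 2) N.
by rewrite -psumZZ; apply: eq_psumZ => n; rewrite exprMn.
Qed.

(** Used to divide an inequality of Cauchy-Schwarz type by a quantity which may
    vanish. *)
Let self_bound (X c : R) : 0 <= X -> X ^+ 2 <= c * X -> 0 <= c -> X <= c.
Proof.
move=> X0; have [->|Xn0] := eqVneq X 0; first by [].
by rewrite expr2 ler_pM2r // lt_neqAle eq_sym Xn0.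
Qed.

(** Bessel's inequality, from the form bound applied to a basis vector and the
    coefficient sequence itself. *)
Lemma coef_l2 F n : symbol F -> l2R (fun m => coef F (n - m)).
Proof.
move=> sF; have [_ [M bF]] := sF.
apply: (@l2R_bound _ _ (M ^+ 2)) => K.
have X0 : 0 <= psumZ (fun m => coef F (n - m) ^+ 2) K by apply: psumZ_ge0 => m; exact: sqr_ge0.
apply: self_bound => //; last exact: sqr_ge0.
have := qf_CS (delta n) (fun m => coef F (n - m)) `|n|%N K sF bF.
have -> : psumZ (fun m => (delta n m : R) ^+ 2) `|n|%N = 1.
  transitivity (psumZ (fun m => (delta n m : R) * 1) `|n|%N).
    by apply: eq_psumZ => m; rewrite /delta mulr1; case: eqP; rewrite ?expr1n ?expr0n.
  by rewrite psumZ_delta leqnn.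
rewrite mulr1; congr (_ ^+ 2 <= _).
transitivity (psumZ (fun k => delta n k * psumZ (fun m => coef F (k - m) * coef F (n - m)) K) `|n|%N).
  by apply: eq_psumZ => k; rewrite -psumZZ; apply: eq_psumZ => m; rewrite mulrA.
by rewrite psumZ_delta leqnn; apply: eq_psumZ => m; rewrite expr2.
Qed.

Arguments coef_l2 [F] n _.

(** The Laurent (two-sided Toeplitz) operator of the symbol, that is the
    operator of multiplication by [F] seen through the Fourier transform. Each
    entry is a convergent inner product, because the rows are square summable. *)
Definition laurent F a : int -> R := fun n => dot (fun m => coef F (n - m)) a.

Lemma cvg_psumZ (x : nat -> int -> R) a N : (forall n, x ^~ n @ \oo --> a n) ->
  (fun i : nat => psumZ (x i) N) @ \oo --> psumZ a N.
Proof.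
move=> xa; elim: N => [|N IH].
  by rewrite /psumZ; under eq_fun do rewrite big_ord1; rewrite big_ord1; exact: xa.
rewrite psumZS; under eq_fun do rewrite psumZS.
by apply: cvgD => //; apply: cvgD.
Qed.

Lemma laurent_trunc F a n K :
  laurent F (trunc K a) n = psumZ (fun m => coef F (n - m) * a m) K.
Proof.
rewrite /laurent dotC dot_trunc; apply: eq_psumZ => m; exact: mulrC.
Qed.

(** Test the bilinear form bound against the truncated image itself, then let
    the truncation of the argument grow. Finite windows on the left keep the
    argument free of any summability assumption on the image. *)
Lemma laurent_psumZ_le F M a N : symbol F -> bounded_by M F -> l2R a ->
  psumZ (fun n => laurent F a n ^+ 2) N <= M ^+ 2 * dot a a.
Proof.
move=> sF bF la.
have H K : psumZ (fun n => laurent F (trunc K a) n ^+ 2) N <= M ^+ 2 * dot a a.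
  apply: le_trans (_ : M ^+ 2 * psumZ (fun n => a n ^+ 2) K <= _); last first.
    by apply: ler_wpM2l; [exact: sqr_ge0|exact: l2R_psumZ_le].
  have S0 : 0 <= psumZ (fun n => a n ^+ 2) K by apply: psumZ_ge0 => n; exact: sqr_ge0.
  apply: self_bound.
  - by apply: psumZ_ge0 => m; exact: sqr_ge0.
  - have := qf_CS (laurent F (trunc K a)) a N K sF bF.
    rewrite mulrAC; congr (_ ^+ 2 <= _).
    apply: eq_psumZ => n; rewrite expr2 {3}laurent_trunc -psumZZ.
    by apply: eq_psumZ => m; rewrite mulrA.
  - by rewrite mulr_ge0 // sqr_ge0.
have C : (fun K => psumZ (fun n => laurent F (trunc K a) n ^+ 2) N) @ \oo -->
    psumZ (fun n => laurent F a n ^+ 2) N.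
  apply: cvg_psumZ => n; under eq_fun do rewrite laurent_trunc expr2.
  have Hn := dot_cvgn (coef_l2 n sF) la.
  exact: (cvgM Hn Hn).
rewrite -(cvg_lim _ C) //; apply: limr_le; first exact: cvgP C.
exact: nearW.
Qed.

Lemma laurent_l2 F a : symbol F -> l2R a -> l2R (laurent F a).
Proof.
move=> sF la; have [_ [M bF]] := sF; apply: l2R_bound => N.
exact: laurent_psumZ_le sF bF la.
Qed.

Lemma dot_laurent_le F M a : symbol F -> bounded_by M F -> l2R a ->
  dot (laurent F a) (laurent F a) <= M ^+ 2 * dot a a.
Proof.
move=> sF bF la; have lc := laurent_l2 sF la.
apply: sumZ_le; first exact: dot_is_cvg.
move=> N; apply: le_trans (laurent_psumZ_le N sF bF la).
by apply: le_psumZ => n; rewrite expr2.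
Qed.

Lemma laurentD F a b : symbol F -> l2R a -> l2R b ->
  laurent F (fun n => a n + b n) = fun n => laurent F a n + laurent F b n.
Proof. by move=> sF la lb; apply/funext => n; apply: dotDr => //; exact: coef_l2. Qed.

Lemma laurentZ (c : R) F a : symbol F -> l2R a ->
  laurent F (fun n => c * a n) = fun n => c * laurent F a n.
Proof. by move=> sF la; apply/funext => n; apply: dotZr => //; exact: coef_l2. Qed.

Lemma laurentB F a b : symbol F -> l2R a -> l2R b ->
  laurent F (fun n => a n - b n) = fun n => laurent F a n - laurent F b n.
Proof. by move=> sF la lb; apply/funext => n; apply: dotBr => //; exact: coef_l2. Qed.

Lemma laurent_symD F G a : symbol F -> symbol G -> l2R a ->
  laurent (fun x => F x + G x) a = fun n => laurent F a n + laurent G a n.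
Proof.
move=> sF sG la; apply/funext => n; rewrite /laurent -dotDl //; try exact: coef_l2.
by congr dot; apply/funext => m; rewrite coefD.
Qed.

Lemma laurent_symZ (c : R) F a : symbol F -> l2R a ->
  laurent (fun x => c * F x) a = fun n => c * laurent F a n.
Proof.
move=> sF la; apply/funext => n; rewrite /laurent -dotZl //; try exact: coef_l2.
by congr dot; apply/funext => m; rewrite coefZ.
Qed.

Lemma laurent_symB F G a : symbol F -> symbol G -> l2R a ->
  laurent (fun x => F x - G x) a = fun n => laurent F a n - laurent G a n.
Proof.
move=> sF sG la.
have -> : (fun x => F x - G x) = (fun x => F x + -1 * G x).
  by apply/funext => x; rewrite mulN1r.
rewrite laurent_symD //; last exact: symbolZ.
by rewrite laurent_symZ //; apply/funext => n; rewrite mulN1r.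
Qed.

Lemma laurent1 a : laurent (fun=> 1) a = a.
Proof.
apply/funext => n; rewrite -[RHS](dot_delta n); congr dot.
by apply/funext => m; rewrite coef1 subr_eq0 /delta eq_sym.
Qed.

Lemma laurent_cst (c : R) a : l2R a -> laurent (fun=> c) a = fun n => c * a n.
Proof.
move=> la; have E := laurent_symZ c (symbol_cst 1) la.
rewrite laurent1 in E; apply: etrans E; congr (laurent _ a).
by apply/funext => x; rewrite mulr1.
Qed.

Lemma laurent_trunc_cvg F a : symbol F -> l2R a ->
  (fun N => dot (fun n => laurent F (trunc N a) n - laurent F a n)
                (fun n => laurent F (trunc N a) n - laurent F a n)) @ \oo --> (0 : R).
Proof.
move=> sF la; have [_ [M bF]] := sF.
have C : (fun N => M ^+ 2 * dot (fun n => trunc N a n - a n) (fun n => trunc N a n - a n))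
    @ \oo --> (0 : R).
  by rewrite -(mulr0 (M ^+ 2)); apply: cvgMr; exact: trunc_cvg.
have lt N := l2R_trunc N a.
apply: (squeeze_cvgr _ (cvg_cst 0) C); apply: nearW => N.
rewrite -(laurentB sF (lt N) la) dot_ge0 /=; last exact: laurent_l2 sF (l2RB (lt N) la).
exact: dot_laurent_le bF (l2RB (lt N) la).
Qed.

Lemma dot_laurent_trunc F a b N :
  dot (trunc N a) (laurent F (trunc N b)) = qf F a b N N.
Proof.
rewrite dot_trunc; apply: eq_psumZ => n; rewrite laurent_trunc -psumZZ.
by apply: eq_psumZ => m; rewrite mulrA.
Qed.

Lemma laurent_sym F a b : symbol F -> l2R a -> l2R b ->
  dot (laurent F a) b = dot a (laurent F b).
Proof.
move=> sF la lb.
have C x y : l2R x -> l2R y ->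
    (fun N => dot (trunc N x) (laurent F (trunc N y))) @ \oo --> dot x (laurent F y).
  move=> lx ly; apply: (@dot_cvg _ (fun N => trunc N x) (fun N => laurent F (trunc N y))).
  - by move=> k; exact: l2R_trunc.
  - by move=> k; exact: (laurent_l2 sF (l2R_trunc k y)).
  - by [].
  - exact: (laurent_l2 sF ly).
  - exact: trunc_cvg.
  - exact: laurent_trunc_cvg.
have E N : dot (trunc N a) (laurent F (trunc N b)) = dot (trunc N b) (laurent F (trunc N a)).
  rewrite !dot_laurent_trunc /qf /psumZ exchange_big; apply: eq_bigr => i _.
  by apply: eq_bigr => j _; rewrite coefB; ring.
rewrite dotC; apply: (cvg_unique _ (C b a lb la)) => //.
by rewrite -(funext E); exact: C.
Qed.

End Convolution.

Arguments coef_l2 {R} [F] n _.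

(** * Weak continuity and multiplicativity in the symbol *)

Section FunctionalCalculus.
Context {R : realType}.
Implicit Types (F G : R -> R) (M : R) (k n m : int) (a b u v : int -> R) (N K : nat).

Definition nrm a : R := Num.sqrt (dot a a).

Lemma sqr_nrm a : l2R a -> nrm a ^+ 2 = dot a a.
Proof. by move=> la; rewrite sqr_sqrtr // dot_ge0. Qed.

Lemma nrm_ge0 a : 0 <= nrm a. Proof. exact: sqrtr_ge0. Qed.

Lemma dot_le_nrm a b : l2R a -> l2R b -> `|dot a b| <= nrm a * nrm b.
Proof.
move=> la lb; rewrite -(ler_pXn2r (n := 2)) ?nnegrE ?mulr_ge0 ?nrm_ge0 //.
by rewrite -normrX ger0_norm ?sqr_ge0 // exprMn !sqr_nrm // dot_CS.
Qed.

Lemma nrm_laurent_le F M a : symbol F -> bounded_by M F -> l2R a ->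
  nrm (laurent F a) <= M * nrm a.
Proof.
move=> sF bF la; have M0 := bounded_by_ge0 bF.
rewrite -(ler_pXn2r (n := 2)) ?nnegrE ?mulr_ge0 ?nrm_ge0 // exprMn !sqr_nrm //.
  exact: dot_laurent_le.
exact: laurent_l2.
Qed.

Lemma nrm_trunc_le N a : l2R a -> nrm (trunc N a) <= nrm a.
Proof.
move=> la; rewrite -(ler_pXn2r (n := 2)) ?nnegrE ?nrm_ge0 // !sqr_nrm //; last exact: l2R_trunc.
rewrite dot_trunc; apply: le_trans (l2R_psumZ_le N la).
by rewrite le_eqVlt; apply/orP; left; apply/eqP; apply: psumZ_in => n nN; rewrite /trunc nN expr2.
Qed.

(** Interchange of two limits, one of them uniform. *)
Lemma cvg_unif (x : nat -> R) (y : R) (xN : nat -> nat -> R) (yN e : nat -> R) :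
  (forall N, xN ^~ N @ \oo --> yN N) ->
  (forall (i N : nat), `|x i - xN i N| <= e N) -> (forall N, `|y - yN N| <= e N) ->
  e @ \oo --> (0 : R) -> x @ \oo --> y.
Proof.
move=> xy xe ye e0; apply/cvgrPdist_le => d d0.
have d3 : 0 < d / 3 by rewrite divr_gt0.
move/cvgrPdist_le : e0 => /(_ _ d3) [N _ /(_ N (leqnn N))] /=.
rewrite sub0r normrN => eN.
move/cvgrPdist_le : (xy N) => /(_ _ d3); apply: filterS => k xk.
have := xe k N; have := ye N; have := ler_norm (e N) => h1 h2 h3.
have -> : y - x k = (y - yN N) + (yN N - xN k N) - (x k - xN k N) by ring.
apply: le_trans (ler_normB _ _) _; have := ler_normD (y - yN N) (yN N - xN k N); lra.
Qed.

Lemma coef_cvg M (F : nat -> R -> R) G k :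
  (forall i, symbol (F i)) -> (forall i, bounded_by M (F i)) -> symbol G ->
  (forall x, F ^~ x @ \oo --> G x) -> (fun i => coef (F i) k) @ \oo --> coef G k.
Proof.
move=> sF bF sG FG; apply: (@avg_cvg _ M).
- by move=> i; apply: symbolM => //; exact: symbol_cosM.
- by move=> i; rewrite -[M]mulr1; apply: bounded_byM => // x; exact: cos_max.
- by apply: symbolM => //; exact: symbol_cosM.
- by move=> x; apply: cvgMl; exact: FG.
Qed.

(** Bounded pointwise convergence of symbols gives weak convergence of the
    operators: on truncated sequences only finitely many coefficients are
    involved, and truncation is uniform in the symbol by the norm bound. *)
Lemma laurent_weak_cvg M (F : nat -> R -> R) G a b :
  (forall i, symbol (F i)) -> (forall i, bounded_by M (F i)) -> symbol G ->
  (forall x, F ^~ x @ \oo --> G x) -> l2R a -> l2R b ->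
  (fun i => dot a (laurent (F i) b)) @ \oo --> dot a (laurent G b).
Proof.
move=> sF bF sG FG la lb.
have bG : bounded_by M G.
  move=> x; have C : (fun i => `|F i x|) @ \oo --> `|G x| by apply: cvg_norm; exact: FG.
  rewrite -(cvg_lim _ C) //; apply: limr_le; first exact: cvgP C.
  by apply: nearW => i; exact: bF.
have M0 := bounded_by_ge0 bG.
pose da N n := trunc N a n - a n; pose db N n := trunc N b n - b n.
have lta N : l2R (trunc N a) := l2R_trunc N a.
have ltb N : l2R (trunc N b) := l2R_trunc N b.
have lda N : l2R (da N) := l2RB (lta N) la.
have ldb N : l2R (db N) := l2RB (ltb N) lb.
pose e N := M * (nrm (da N) * nrm b + nrm a * nrm (db N)).
have H H0 N : symbol H0 -> bounded_by M H0 ->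
    `|dot a (laurent H0 b) - dot (trunc N a) (laurent H0 (trunc N b))| <= e N.
  move=> sH bH.
  have E : dot a (laurent H0 b) - dot (trunc N a) (laurent H0 (trunc N b)) =
      - dot (da N) (laurent H0 b) - dot (trunc N a) (laurent H0 (db N)).
    rewrite (dotBl (lta N) la (laurent_l2 sH lb)) (laurentB sH (ltb N) lb).
    rewrite (dotBr (lta N) (laurent_l2 sH (ltb N)) (laurent_l2 sH lb)); ring.
  rewrite E; apply: le_trans (ler_normB _ _) _; rewrite normrN /e mulrDr; apply: lerD.
    apply: le_trans (dot_le_nrm (lda N) (laurent_l2 sH lb)) _.
    by rewrite mulrCA; apply: ler_wpM2l; [exact: nrm_ge0|exact: nrm_laurent_le].
  apply: le_trans (dot_le_nrm (lta N) (laurent_l2 sH (ldb N))) _.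
  rewrite mulrCA; apply: ler_pM; rewrite ?nrm_ge0 //; first exact: nrm_trunc_le.
  exact: nrm_laurent_le.
apply: (@cvg_unif _ _ (fun i N => dot (trunc N a) (laurent (F i) (trunc N b)))
  (fun N => dot (trunc N a) (laurent G (trunc N b))) e).
- move=> N; rewrite dot_trunc; under eq_fun do rewrite dot_trunc.
  apply: cvg_psumZ => n; apply: cvgMr.
  rewrite laurent_trunc; under eq_fun do rewrite laurent_trunc.
  by apply: cvg_psumZ => m; apply: cvgMl; exact: coef_cvg FG.
- by move=> i N; exact: H.
- by move=> N; exact: H.
- have S (c : nat -> int -> R) : (fun N => dot (c N) (c N)) @ \oo --> (0 : R) ->
      (fun N => nrm (c N)) @ \oo --> (0 : R).
    move=> c0; rewrite -[X in _ --> X]sqrtr0.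
    apply: (@continuous_cvg _ _ _ _ _ _ Num.sqrt) => //; exact: sqrt_continuous.
  have Sa := S _ (trunc_cvg la); have Sb := S _ (trunc_cvg lb).
  have Sa' : (fun N => nrm (da N) * nrm b) @ \oo --> 0 * nrm b by apply: cvgMl; exact: Sa.
  have Sb' : (fun N => nrm a * nrm (db N)) @ \oo --> nrm a * 0 by apply: cvgMr; exact: Sb.
  have := cvgD Sa' Sb'; rewrite mul0r mulr0 addr0 => Sab.
  by rewrite -(mulr0 M); apply: cvgMr; exact: Sab.
Qed.

Lemma laurent_weak_cvg_pt M (F : nat -> R -> R) G a n :
  (forall i, symbol (F i)) -> (forall i, bounded_by M (F i)) -> symbol G ->
  (forall x, F ^~ x @ \oo --> G x) -> l2R a ->
  (fun i => laurent (F i) a n) @ \oo --> laurent G a n.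
Proof.
move=> sF bF sG FG la; have := laurent_weak_cvg sF bF sG FG (l2R_delta n) la.
by rewrite dot_delta; under eq_fun do rewrite dot_delta.
Qed.

(** [F] is multiplicative when the operator with symbol [F * G] is the product
    for every [G]; the class of these symbols is closed under all the operations
    that lead from the cosine to the indicators of Borel sets. *)
Definition mult_symbol F := symbol F /\
  forall G a, symbol G -> l2R a -> laurent (fun x => F x * G x) a = laurent F (laurent G a).

Lemma mult_cst (c : R) : mult_symbol (fun=> c).
Proof.
split=> [|G a sG la]; first exact: symbol_cst.
by rewrite laurent_symZ // laurent_cst //; exact: laurent_l2.
Qed.

Lemma multD F G : mult_symbol F -> mult_symbol G -> mult_symbol (fun x => F x + G x).
Proof.
move=> [sF mF] [sG mG]; split=> [|H a sH la]; first exact: symbolD.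
rewrite laurent_symD //; last exact: laurent_l2.
rewrite -mF // -mG // -laurent_symD //; try exact: symbolM.
by congr (laurent _ a); apply/funext => x; rewrite mulrDl.
Qed.

Lemma multM F G : mult_symbol F -> mult_symbol G -> mult_symbol (fun x => F x * G x).
Proof.
move=> [sF mF] [sG mG]; split=> [|H a sH la]; first exact: symbolM.
have lH := laurent_l2 sH la.
rewrite mF // -mG // -mF //; last exact: symbolM.
by congr (laurent _ a); apply/funext => x; rewrite mulrA.
Qed.

Lemma multZ (c : R) F : mult_symbol F -> mult_symbol (fun x => c * F x).
Proof. exact: multM (mult_cst c). Qed.

Lemma multX F N : mult_symbol F -> mult_symbol (fun x => F x ^+ N).
Proof.
move=> mF; elim: N => [|N IH]; first by under eq_fun do rewrite expr0; exact: mult_cst.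
by under eq_fun do rewrite exprS; exact: multM.
Qed.

Lemma multB F G : mult_symbol F -> mult_symbol G -> mult_symbol (fun x => F x - G x).
Proof.
move=> mF mG; have := multD mF (multZ (-1) mG).
by congr mult_symbol; apply/funext => x; rewrite mulN1r.
Qed.

(** Both sides of the product rule are weakly continuous along bounded pointwise
    limits: the left side because [F i * H] converges, the right side because
    [laurent H a] is a fixed square-summable sequence. *)
Lemma mult_cvg M (F : nat -> R -> R) G :
  (forall i, mult_symbol (F i)) -> (forall i, bounded_by M (F i)) -> symbol G ->
  (forall x, F ^~ x @ \oo --> G x) -> mult_symbol G.
Proof.
move=> mF bF sG FG; split=> // H a sH la; apply/funext => n.
have [_ [N bH]] := sH.
have C1 : (fun i => laurent (fun x => F i x * H x) a n) @ \oo --> laurent (fun x => G x * H x) a n.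
  apply: (@laurent_weak_cvg_pt (M * N)) => //.
  - by move=> i; apply: symbolM => //; have [] := mF i.
  - by move=> i; exact: bounded_byM.
  - exact: symbolM.
  - by move=> x; apply: cvgMl; exact: FG.
apply: (cvg_unique _ C1) => //.
have E i : laurent (fun x => F i x * H x) a n = laurent (F i) (laurent H a) n by rewrite (mF i).2.
rewrite (funext E); apply: (@laurent_weak_cvg_pt M) => //.
  by move=> i; have [] := mF i.
exact: laurent_l2.
Qed.

(** The product-to-sum formula on the level of coefficients: multiplication by
    [cos (k x)] is half the sum of two opposite shifts. Every multiplicativity
    statement starts from here. *)
Lemma laurent_cosM k F a n : symbol F -> l2R a ->
  laurent (fun x => cos (k%:~R * x) * F x) a n = 2^-1 * (laurent F a (n - k) + laurent F a (n + k)).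
Proof.
move=> sF la; rewrite /laurent -dotDl //; try exact: coef_l2.
rewrite -dotZl //; last by apply: l2RD; exact: coef_l2.
congr (dot _ a); apply/funext => m.
have sc j : symbol (fun x => F x * cos (j%:~R * x)) by apply: symbolM => //; exact: symbol_cosM.
rewrite /coef -avgD // -avgZ; last exact: symbolD.
congr avg; apply/funext => x.
have -> : (n - k - m)%:~R * x = (n - m)%:~R * x - k%:~R * x by rewrite !intrB; ring.
have -> : (n + k - m)%:~R * x = (n - m)%:~R * x + k%:~R * x by rewrite !intrB intrD; ring.
by rewrite cosB cosD; field.
Qed.

Lemma laurent_cosM1 k a n : l2R a ->
  laurent (fun x => cos (k%:~R * x)) a n = 2^-1 * (a (n - k) + a (n + k)).
Proof.
move=> la; have := laurent_cosM k n (symbol_cst 1) la; rewrite laurent1 => <-.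
by congr (laurent _ a n); apply/funext => x; rewrite mulr1.
Qed.

Lemma mult_cosM k : mult_symbol (fun x => cos (k%:~R * x)).
Proof.
split=> [|G a sG la]; first exact: symbol_cosM.
apply/funext => n; rewrite laurent_cosM // laurent_cosM1 //; exact: laurent_l2.
Qed.

Lemma mult_cos : mult_symbol (@cos R).
Proof. by have := mult_cosM 1; congr mult_symbol; apply/funext => x; rewrite mul1r. Qed.

Lemma mult_polycos (p : {poly R}) : mult_symbol (fun x => p.[cos x]).
Proof.
elim/poly_ind: p => [|p c IH].
  by under eq_fun do rewrite horner0; exact: mult_cst.
under eq_fun do rewrite hornerMXaddC.
by apply: multD; [exact: multM IH mult_cos|exact: mult_cst].
Qed.

End FunctionalCalculus.

(** * Indicators of Borel sets *)

Section BorelIndicators.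
Context {R : realType}.
Implicit Types (F G : R -> R) (a b : int -> R) (r s t : R) (B : set R).

Lemma bernoulli_ge (h : R) (n : nat) : 0 <= h -> n%:R * h <= (1 + h) ^+ n.
Proof.
move=> h0; suff H : 1 + n%:R * h <= (1 + h) ^+ n by lra.
elim: n => [|n IH]; first by rewrite mul0r addr0 expr0.
rewrite exprS -addn1 natrD.
have n0 : 0 <= n%:R :> R by [].
have : (1 + h) * (1 + n%:R * h) <= (1 + h) * (1 + h) ^+ n by apply: ler_wpM2l => //; lra.
have := mulr_ge0 n0 (sqr_ge0 h); nra.
Qed.

Lemma bernoulli_le (y : R) (n : nat) : 0 <= y <= 1 -> 1 - n%:R * y <= (1 - y) ^+ n.
Proof.
move=> /andP[y0 y1]; elim: n => [|n IH]; first by rewrite mul0r subr0 expr0.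
rewrite exprS -addn1 natrD.
have n0 : 0 <= n%:R :> R by [].
have : (1 - y) * (1 - n%:R * y) <= (1 - y) * (1 - y) ^+ n by apply: ler_wpM2l => //; lra.
have := mulr_ge0 n0 (sqr_ge0 y); nra.
Qed.

Lemma cvg_natMexpr s : 0 <= s < 1 -> (fun n => n%:R * s ^+ n) @ \oo --> (0 : R).
Proof.
move=> /andP[s0 s1].
have [->|sn0] := eqVneq s 0.
  apply: (cvg_trans _ (@cvg_cst _ (0 : R) _ \oo _)).
  by apply: near_eq_cvg; near=> n; rewrite expr0n; case: (n) => [|k] /=; rewrite ?mul0r ?mulr0.
(* Writing [s = q ^ 2], one factor [q ^ n] absorbs [n] and the other one
   tends to zero. *)
pose q := Num.sqrt s.
have sp : 0 < s by rewrite lt_neqAle eq_sym sn0.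
have qp : 0 < q by rewrite sqrtr_gt0.
have qs : q ^+ 2 = s by rewrite sqr_sqrtr.
have q1 : q < 1 by rewrite -sqrtr1 ltr_sqrt.
pose h := q^-1 - 1.
have hp : 0 < h by rewrite subr_gt0 invf_gt1.
have C : (fun n => h^-1 * q ^+ n) @ \oo --> (0 : R).
  rewrite -(mulr0 h^-1); apply: cvgMr; apply: cvg_expr.
  by rewrite ger0_norm // ltW.
apply: (squeeze_cvgr _ (cvg_cst 0) C); apply: nearW => n.
rewrite mulr_ge0 ?exprn_ge0 //=.
rewrite -qs exprAC expr2 mulrA; apply: ler_wpM2r; first by rewrite exprn_ge0 // ltW.
rewrite -ler_pdivlMr ?exprn_gt0 // ler_pdivlMl //.
have := bernoulli_ge n (ltW hp).
have -> : 1 + h = q^-1 by rewrite /h; ring.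
by rewrite exprVn mulrC.
Unshelve. all: by end_near. Qed.

(** These are the functions by which the Stone-Weierstrass theorem is often
    proved. By Bernoulli's inequality [(1 - t ^ n) ^ (n 2 ^ n)] differs from 1
    by at most [n (2 t) ^ n], which vanishes in the limit below one half; and it
    is at most [1 / n] from one half on, because [(1 - t ^ n) (1 + t ^ n) <= 1].
    The factor [n] in the exponent is what makes the limit at one half exact. *)
Lemma cvg_threshold t : 0 <= t <= 1 ->
  (fun n => (1 - t ^+ n) ^+ (n * 2 ^ n)) @ \oo --> (if t < 2^-1 then 1 else 0 : R).
Proof.
move=> /andP[t0 t1].
have tn n : 0 <= t ^+ n <= 1 by rewrite exprn_ge0 //= exprn_ile1.
have p1 n : (1 - t ^+ n) ^+ (n * 2 ^ n) <= 1.
  by have /andP[??] := tn n; apply: exprn_ile1; lra.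
case: ltP => tlt /=.
- have C : (fun n => 1 - n%:R * (2 * t) ^+ n) @ \oo --> (1 : R).
    rewrite -[X in _ --> X]subr0; apply: cvgB; first exact: cvg_cst.
    by apply: cvg_natMexpr; lra.
  apply: (squeeze_cvgr _ C (@cvg_cst _ (1 : R) _ _ _)); apply: nearW => n.
  rewrite p1 andbT; apply: le_trans (bernoulli_le _ (tn n)).
  by rewrite natrM natrX exprMn mulrA.
- have C : (fun n => n%:R^-1) @ \oo --> (0 : R).
    apply/cvgrPdist_lt => e e0; near=> n.
    rewrite sub0r normrN ger0_norm ?invr_ge0 // invf_plt ?posrE //.
      by near: n; exact: nbhs_infty_gtr.
    by rewrite ltr0n; near: n; exact: nbhs_infty_gt.
  apply: (squeeze_cvgr _ (cvg_cst 0) C); near=> n.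
  have np : 0 < n%:R :> R by rewrite ltr0n; near: n; exact: nbhs_infty_gt.
  have /andP[tn0 tn1] := tn n.
  have P0 : 0 <= (1 - t ^+ n) ^+ (n * 2 ^ n) by apply: exprn_ge0; lra.
  rewrite P0 /= -[leRHS]mul1r ler_pdivlMr //.
  have h1 : n%:R <= (1 + t ^+ n) ^+ (n * 2 ^ n).
    apply: le_trans (bernoulli_ge _ tn0).
    rewrite natrM natrX -mulrA -exprMn -[leLHS]mulr1 ler_wpM2l //.
    by apply: exprn_ege1; lra.
  apply: le_trans (ler_wpM2l P0 h1) _.
  rewrite -exprMn -subr_sqr expr1n; apply: exprn_ile1.
    by rewrite subr_ge0 exprn_ile1.
  by rewrite lerBlDr lerDl sqr_ge0.
Unshelve. all: by end_near. Qed.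

(** The indicator of a half-line is a bounded pointwise limit of polynomials in
    the cosine, and multiplicativity passes to such limits. *)
Lemma mult_icos_ray r : mult_symbol (icos `]-oo, r[).
Proof.
have indE x : icos `]-oo, r[ x = if cos x < r then 1 else 0.
  rewrite /icos indicE; case: ltP => h.
    by rewrite mem_set //= in_itv.
  by rewrite memNset //= in_itv /= ltNge h.
have [r1|r1] := ltP 1 r.
  have -> : icos `]-oo, r[ = fun=> 1 by apply/funext => x; rewrite indE (le_lt_trans (cos_le1 x) r1).
  exact: mult_cst.
have [r2|r2] := ltP r (-1).
  have -> : icos `]-oo, r[ = fun=> 0.
    by apply/funext => x; rewrite indE ltNge (le_trans (ltW r2) (cos_geN1 x)).
  exact: mult_cst.
(* The affine map that sends [r] to one half and keeps the range of the
   cosine inside the unit interval. *)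
pose t x : R := 4^-1 * cos x + (2^-1 - 4^-1 * r).
have t01 x : 0 <= t x <= 1.
  by rewrite /t; have := cos_le1 x; have := cos_geN1 x => ? ?; apply/andP; split; lra.
have mt : mult_symbol t by apply: multD; [apply: multZ; exact: mult_cos|exact: mult_cst].
apply: (@mult_cvg _ 1 (fun n x => (1 - t x ^+ n) ^+ (n * 2 ^ n))).
- move=> n; apply: multX; apply: multB; first exact: mult_cst.
  exact: multX.
- move=> n x; have /andP[t0 t1] := t01 x.
  have : 0 <= t x ^+ n <= 1 by rewrite exprn_ge0 //= exprn_ile1.
  move=> /andP[? ?]; rewrite normrX; apply: exprn_ile1 => //.
  by rewrite ger0_norm; lra.
- by apply: symbol_icos; exact: measurable_itv.
- move=> x; rewrite indE.
  have -> : (cos x < r) = (t x < 2^-1).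
    by rewrite /t; apply/idP/idP => ?; lra.
  exact: cvg_threshold.
Qed.

Lemma icosC B x : icos (~` B) x = 1 - icos B x.
Proof.
rewrite /icos !indicE; have [h|h] := pselect (B (cos x)).
  by rewrite (mem_set h) memNset ?subrr // => /(_ h).
by rewrite (memNset h) mem_set ?subr0.
Qed.

Lemma icosI B B' x : icos (B `&` B') x = icos B x * icos B' x.
Proof. by rewrite /icos indicI. Qed.

Lemma icos_bigcup (B_ : (set R)^nat) x :
  (fun n => icos (\bigcup_(i < n) B_ i) x) @ \oo --> icos (\bigcup_i B_ i) x.
Proof.
have [[i _ Bi]|nB] := pselect ((\bigcup_i B_ i) (cos x)).
  apply: cvg_near_cst; exists i.+1 => // n /= lin; rewrite /icos !indicE !mem_set //.
    by exists i.
  by exists i.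
apply: cvg_near_cst; apply: nearW => n; rewrite /icos !indicE !memNset //.
by move=> [i _ Bi]; apply: nB; exists i.
Qed.

(** The sets whose indicator is multiplicative form a sigma-algebra: complements
    and intersections correspond to differences and products of symbols, and
    countable unions are bounded pointwise limits. It contains the half-lines,
    which generate the Borel sets. *)
Lemma mult_icos (B : set (measurableTypeR R)) : measurable B -> mult_symbol (icos B).
Proof.
have mE : (@measurable _ (measurableTypeR R)) = (@RGenInftyO.G R).-sigma.-measurable.
  exact: RGenInftyO.measurableE.
rewrite mE.
move=> mB; suff : measurable B /\ mult_symbol (icos B) by case.
move: B mB; apply: smallest_sub; last first.
  by move=> _ [r ->]; split; [exact: measurable_itv|exact: mult_icos_ray].
have CC (A : set (measurableTypeR R)) : measurable A /\ mult_symbol (icos A) ->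
    measurable (~` A) /\ mult_symbol (icos (~` A)).
  move=> [mA iA]; split; first exact: measurableC.
  rewrite (funext (icosC A)); apply: multB => //; exact: mult_cst.
have II (A A' : set (measurableTypeR R)) : measurable A /\ mult_symbol (icos A) ->
    measurable A' /\ mult_symbol (icos A') ->
    measurable (A `&` A') /\ mult_symbol (icos (A `&` A')).
  move=> [mA iA] [mA' iA']; split; first exact: measurableI.
  by rewrite (funext (icosI A A')); exact: multM.
have C0 : measurable (set0 : set (measurableTypeR R)) /\ mult_symbol (icos (set0 : set R)).
  split; first exact: measurable0.
  have -> : icos (set0 : set R) = fun=> 0 by apply/funext => x; rewrite /icos indic0.
  exact: mult_cst.
split.
- exact: C0.
- by move=> A hA; rewrite setTD; exact: CC.
- move=> A_ hA.
  have H n : measurable (\bigcup_(i < n) A_ i : set (measurableTypeR R)) /\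
      mult_symbol (icos (\bigcup_(i < n) A_ i)).
    elim: n => [|n IH]; first by rewrite bigcup_mkord big_ord0.
    rewrite bigcup_mkord big_ord_recr /= -bigcup_mkord -[X in measurable X]setCK -[X in icos X]setCK setCU.
    by apply: (CC); apply: (II); apply: (CC).
  have mU : measurable (\bigcup_i A_ i : set (measurableTypeR R)).
    by apply: bigcupT_measurable => i; have [] := hA i.
  split=> //; apply: (@mult_cvg _ 1 (fun n => icos (\bigcup_(i < n) A_ i))).
  - by move=> n; have [] := H n.
  - by move=> n; exact: icos_bounded.
  - exact: symbol_icos.
  - by move=> x; exact: icos_bigcup.
Qed.

(** Commutation follows from multiplicativity of one factor by taking adjoints. *)
Lemma multC F G a : mult_symbol F -> symbol G -> l2R a ->
  laurent G (laurent F a) = laurent F (laurent G a).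
Proof.
move=> [sF mF] sG la; apply/funext => n.
have lF := laurent_l2 sF la; have lG := laurent_l2 sG la.
have ld := l2R_delta n : l2R (delta n : int -> R).
rewrite -(dot_delta n) -(dot_delta n (laurent F _)).
rewrite -laurent_sym // -laurent_sym //; last exact: laurent_l2.
rewrite -mF // laurent_sym //; last exact: symbolM.
by rewrite mF.
Qed.

End BorelIndicators.

(** * Complex sequences *)

Section ComplexSequences.
Context {R : realType}.
Local Open Scope complex_scope.
Implicit Types (F G : R -> R) (a b : int -> R) (u v w : seqZ R) (M : R).

Definition reS u : int -> R := fun n => complex.Re (u n).
Definition imS u : int -> R := fun n => complex.Im (u n).

Lemma seqZ_eq u v : reS u = reS v -> imS u = imS v -> u = v.
Proof.
move=> hr hi; apply/funext => n.
have := congr1 (fun f => f n) hr; have := congr1 (fun f => f n) hi.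
by rewrite /reS /imS; case: (u n) (v n) => [x y] [x' y'] /= -> ->.
Qed.

Lemma l2P u : l2 u <-> l2R (reS u) /\ l2R (imS u).
Proof.
split=> [lu|[lr li]].
  split; apply: (psumZ_cvg (M := sumZ (fun n => sqmod (u n)))) => [n|N];
    rewrite ?sqr_ge0 //; apply: le_trans (psumZ_le_sumZ N _ lu);
    try (by move=> n; rewrite addr_ge0 ?sqr_ge0);
    by apply: le_psumZ => n; rewrite /sqmod /reS /imS ?lerDl ?lerDr sqr_ge0.
have E N : psumZ (fun n => sqmod (u n)) N =
    psumZ (fun n => reS u n ^+ 2) N + psumZ (fun n => imS u n ^+ 2) N.
  by rewrite -psumZD.
by rewrite /l2 (funext E); exact: is_cvgD.
Qed.

Lemma l2_re u : l2 u -> l2R (reS u). Proof. by move=> /l2P[]. Qed.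
Lemma l2_im u : l2 u -> l2R (imS u). Proof. by move=> /l2P[]. Qed.
#[local] Hint Resolve l2_re l2_im : core.

(** The real inner product underlying the complex one. The forms of symmetric
    operators are real, so that nearly all estimates can be done with it. *)
Definition rdot u v : R := dot (reS u) (reS v) + dot (imS u) (imS v).

Lemma normsqE u : l2 u -> normsq u = rdot u u.
Proof.
move=> /l2P[lr li]; apply: cvg_lim => //.
have E N : psumZ (fun n => sqmod (u n)) N =
    psumZ (fun n => reS u n * reS u n) N + psumZ (fun n => imS u n * imS u n) N.
  by rewrite -psumZD; apply: eq_psumZ => n; rewrite -!expr2.
by rewrite (funext E); apply: cvgD; exact: dot_cvgn.
Qed.

Lemma innerE u v : l2 u -> l2 v ->
  inner u v = rdot u v +i* (dot (reS u) (imS v) - dot (imS u) (reS v)).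
Proof.
move=> /l2P[ur ui] /l2P[vr vi]; rewrite /inner; congr (_ +i* _); apply: cvg_lim => //.
  have E N : psumZ (fun n => complex.Re ((u n)^*%C * v n)) N =
      psumZ (fun n => reS u n * reS v n) N + psumZ (fun n => imS u n * imS v n) N.
    rewrite -psumZD; apply: eq_psumZ => n; rewrite /reS /imS.
    by case: (u n) (v n) => [x y] [x' y'] /=; ring.
  by rewrite (funext E); apply: cvgD; exact: dot_cvgn.
have E N : psumZ (fun n => complex.Im ((u n)^*%C * v n)) N =
    psumZ (fun n => reS u n * imS v n) N - psumZ (fun n => imS u n * reS v n) N.
  rewrite -mulN1r -psumZZ -psumZD; apply: eq_psumZ => n; rewrite /reS /imS.
  by case: (u n) (v n) => [x y] [x' y'] /=; ring.
by rewrite (funext E); apply: cvgB; exact: dot_cvgn.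
Qed.

Lemma Re_inner u v : l2 u -> l2 v -> complex.Re (inner u v) = rdot u v.
Proof. by move=> lu lv; rewrite innerE. Qed.

Lemma inner_self u : l2 u -> inner u u = (rdot u u)%:C.
Proof. by move=> lu; rewrite innerE // (dotC (imS u)) subrr. Qed.

Lemma l2_lin (c : R[i]) u v : l2 u -> l2 v -> l2 (fun n => c * u n + v n).
Proof.
move=> /l2P[ur ui] /l2P[vr vi]; apply/l2P; case: c => c d; split.
  have -> : reS (fun n => (c +i* d) * u n + v n) = fun n => (c * reS u n - d * imS u n) + reS v n.
    by apply/funext => n; rewrite /reS /imS; case: (u n) (v n) => [x y] [x' y'].
  apply: l2RD => //; apply: l2RB; exact: l2RZ.
have -> : imS (fun n => (c +i* d) * u n + v n) = fun n => (c * imS u n + d * reS u n) + imS v n.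
  by apply/funext => n; rewrite /reS /imS; case: (u n) (v n) => [x y] [x' y'] /=; ring.
apply: l2RD => //; apply: l2RD; exact: l2RZ.
Qed.

Lemma reSD u v : reS (fun n => u n + v n) = fun n => reS u n + reS v n.
Proof. by apply/funext => n; rewrite /reS; case: (u n) (v n) => [x y] [x' y']. Qed.
Lemma imSD u v : imS (fun n => u n + v n) = fun n => imS u n + imS v n.
Proof. by apply/funext => n; rewrite /imS; case: (u n) (v n) => [x y] [x' y']. Qed.
Lemma reSB u v : reS (fun n => u n - v n) = fun n => reS u n - reS v n.
Proof. by apply/funext => n; rewrite /reS; case: (u n) (v n) => [x y] [x' y']. Qed.
Lemma imSB u v : imS (fun n => u n - v n) = fun n => imS u n - imS v n.
Proof. by apply/funext => n; rewrite /imS; case: (u n) (v n) => [x y] [x' y']. Qed.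
Lemma reSZ (c : R) u : reS (fun n => c%:C * u n) = fun n => c * reS u n.
Proof. by apply/funext => n; rewrite /reS; case: (u n) => [x y] /=; ring. Qed.
Lemma imSZ (c : R) u : imS (fun n => c%:C * u n) = fun n => c * imS u n.
Proof. by apply/funext => n; rewrite /imS; case: (u n) => [x y] /=; ring. Qed.

Lemma l2D u v : l2 u -> l2 v -> l2 (fun n => u n + v n).
Proof. by move=> /l2P[??] /l2P[??]; apply/l2P; rewrite reSD imSD; split; exact: l2RD. Qed.
Lemma l2B u v : l2 u -> l2 v -> l2 (fun n => u n - v n).
Proof. by move=> /l2P[??] /l2P[??]; apply/l2P; rewrite reSB imSB; split; exact: l2RB. Qed.
Lemma l2Z (c : R) u : l2 u -> l2 (fun n => c%:C * u n).
Proof. by move=> /l2P[??]; apply/l2P; rewrite reSZ imSZ; split; exact: l2RZ. Qed.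

Arguments l2Z c [u] _.

Lemma rdotC u v : rdot u v = rdot v u.
Proof. by rewrite /rdot (dotC (reS u)) (dotC (imS u)). Qed.

Lemma rdotDl u v w : l2 u -> l2 v -> l2 w ->
  rdot (fun n => u n + v n) w = rdot u w + rdot v w.
Proof.
move=> /l2P[ur ui] /l2P[vr vi] /l2P[wr wi]; rewrite /rdot reSD imSD.
by rewrite (dotDl ur vr wr) (dotDl ui vi wi); ring.
Qed.

Lemma rdotBl u v w : l2 u -> l2 v -> l2 w ->
  rdot (fun n => u n - v n) w = rdot u w - rdot v w.
Proof.
move=> /l2P[ur ui] /l2P[vr vi] /l2P[wr wi]; rewrite /rdot reSB imSB.
by rewrite (dotBl ur vr wr) (dotBl ui vi wi); ring.
Qed.

Lemma rdotZl (c : R) u v : l2 u -> l2 v -> rdot (fun n => c%:C * u n) v = c * rdot u v.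
Proof.
move=> /l2P[ur ui] /l2P[vr vi]; rewrite /rdot reSZ imSZ.
by rewrite (dotZl c ur vr) (dotZl c ui vi); ring.
Qed.

Arguments rdotZl c [u v] _ _.

Lemma rdotDr u v w : l2 u -> l2 v -> l2 w ->
  rdot u (fun n => v n + w n) = rdot u v + rdot u w.
Proof. by move=> lu lv lw; rewrite rdotC rdotDl // !(rdotC u). Qed.

Lemma rdotBr u v w : l2 u -> l2 v -> l2 w ->
  rdot u (fun n => v n - w n) = rdot u v - rdot u w.
Proof. by move=> lu lv lw; rewrite rdotC rdotBl // !(rdotC u). Qed.

Lemma rdotZr (c : R) u v : l2 u -> l2 v -> rdot u (fun n => c%:C * v n) = c * rdot u v.
Proof. by move=> lu lv; rewrite rdotC rdotZl // (rdotC u). Qed.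

Arguments rdotZr c [u v] _ _.

Lemma rdot_ge0 u : l2 u -> 0 <= rdot u u.
Proof. by move=> /l2P[ur ui]; apply: addr_ge0; exact: dot_ge0. Qed.

Lemma rdot_eq0 u : l2 u -> rdot u u <= 0 -> u = fun=> 0.
Proof.
move=> /l2P[ur ui] h; have := dot_ge0 ur; have := dot_ge0 ui; rewrite /rdot in h => h1 h2.
have hr : reS u = fun=> 0 by apply: dot0_eq0 => //; lra.
have hi : imS u = fun=> 0 by apply: dot0_eq0 => //; lra.
by apply: seqZ_eq.
Qed.

Lemma rdot_CS u v : l2 u -> l2 v -> rdot u v ^+ 2 <= rdot u u * rdot v v.
Proof.
move=> lu lv; rewrite -[rdot u u]mul1r -[1](expr1n _ 2).
apply: discr_le => //; [exact: rdot_ge0|exact: rdot_ge0|] => s.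
have lsu := l2Z s lu.
have := rdot_ge0 (l2B lsu lv).
rewrite (rdotBl lsu lv (l2B lsu lv)) (rdotBr lsu lsu lv) (rdotBr lv lsu lv).
rewrite (rdotZl s lu lsu) (rdotZr s lu lu) (rdotZl s lu lv) (rdotZr s lv lu).
by rewrite (rdotC v u); lra.
Qed.

Lemma l2_0 : l2 (fun=> 0 : R[i]).
Proof. by apply/l2P; split; exact: l2R0. Qed.

(** Laurent matrices of even real symbols are real, so the operator acts
    separately on real and imaginary parts. *)
Definition claurent F : oper R := fun u n => laurent F (reS u) n +i* laurent F (imS u) n.

Lemma claurent_l2 F u : symbol F -> l2 u -> l2 (claurent F u).
Proof. by move=> sF /l2P[ur ui]; apply/l2P; split; exact: laurent_l2. Qed.

Lemma claurent_lin F (c : R[i]) u v : symbol F -> l2 u -> l2 v ->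
  claurent F (fun n => c * u n + v n) = fun n => c * claurent F u n + claurent F v n.
Proof.
move=> sF /l2P[ur ui] /l2P[vr vi]; case: c => c d; apply: seqZ_eq.
  have -> : reS (claurent F (fun n => (c +i* d) * u n + v n)) =
      laurent F (fun n => (c * reS u n - d * imS u n) + reS v n).
    congr laurent; apply/funext => n.
    by rewrite /reS /imS; case: (u n) (v n) => [x y] [x' y'].
  have l1 := l2RZ c ur; have l2 := l2RZ d ui.
  rewrite (laurentD sF (l2RB l1 l2) vr) (laurentB sF l1 l2) (laurentZ c sF ur) (laurentZ d sF ui).
  by apply/funext => n.
have -> : imS (claurent F (fun n => (c +i* d) * u n + v n)) =
    laurent F (fun n => (c * imS u n + d * reS u n) + imS v n).
  congr laurent; apply/funext => n.
  by rewrite /reS /imS; case: (u n) (v n) => [x y] [x' y'] /=; ring.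
have l1 := l2RZ c ui; have l2 := l2RZ d ur.
rewrite (laurentD sF (l2RD l1 l2) vi) (laurentD sF l1 l2) (laurentZ c sF ui) (laurentZ d sF ur).
by apply/funext => n; rewrite /imS /=; ring.
Qed.

Lemma claurent_rdot_le F M u : symbol F -> bounded_by M F -> l2 u ->
  rdot (claurent F u) (claurent F u) <= M ^+ 2 * rdot u u.
Proof.
by move=> sF bF /l2P[ur ui]; rewrite /rdot mulrDr; apply: lerD; exact: dot_laurent_le.
Qed.

Lemma claurent_bounded F : symbol F -> bounded_op (claurent F).
Proof.
move=> sF; split; first by move=> u; exact: claurent_l2.
  by move=> c u v; exact: claurent_lin.
have [_ [M bF]] := sF; exists (M ^+ 2) => u lu.
rewrite !normsqE //; first exact: claurent_rdot_le.
exact: claurent_l2.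
Qed.

Lemma claurent_rsym F u v : symbol F -> l2 u -> l2 v ->
  rdot (claurent F u) v = rdot u (claurent F v).
Proof.
by move=> sF /l2P[ur ui] /l2P[vr vi]; rewrite /rdot; congr (_ + _); exact: laurent_sym.
Qed.

Lemma claurent_sym F u v : symbol F -> l2 u -> l2 v ->
  inner (claurent F u) v = inner u (claurent F v).
Proof.
move=> sF lu lv; have lFu := claurent_l2 sF lu; have lFv := claurent_l2 sF lv.
rewrite (innerE lFu lv) (innerE lu lFv) claurent_rsym //; congr (_ +i* (_ - _)).
  exact: (laurent_sym sF (l2_re lu) (l2_im lv)).
exact: (laurent_sym sF (l2_im lu) (l2_re lv)).
Qed.

Lemma claurent_inner_real F u : symbol F -> l2 u ->
  inner u (claurent F u) = (rdot u (claurent F u))%:C.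
Proof.
move=> sF lu; have lFu := claurent_l2 sF lu.
rewrite innerE //; congr (_ +i* _).
rewrite -[dot (reS u) _](laurent_sym sF (l2_re lu) (l2_im lu)) (dotC (imS u)).
by rewrite subrr.
Qed.

Lemma claurentM F G u : mult_symbol F -> symbol G -> l2 u ->
  claurent (fun x => F x * G x) u = claurent F (claurent G u).
Proof.
by move=> [_ mF] sG /l2P[ur ui]; apply: seqZ_eq; exact: mF.
Qed.

Lemma claurentC F G u : mult_symbol F -> symbol G -> l2 u ->
  claurent G (claurent F u) = claurent F (claurent G u).
Proof. by move=> mF sG /l2P[ur ui]; apply: seqZ_eq; exact: multC. Qed.

Lemma claurent_cst (c : R) u : l2 u -> claurent (fun=> c) u = fun n => c%:C * u n.
Proof.
move=> /l2P[ur ui]; apply: seqZ_eq; rewrite ?reSZ ?imSZ; exact: laurent_cst.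
Qed.

Lemma claurent1 u : claurent (fun=> 1) u = u.
Proof. by apply: seqZ_eq; exact: laurent1. Qed.

Lemma claurent_symD F G u : symbol F -> symbol G -> l2 u ->
  claurent (fun x => F x + G x) u = fun n => claurent F u n + claurent G u n.
Proof.
move=> sF sG /l2P[ur ui]; apply: seqZ_eq; rewrite ?reSD ?imSD; exact: laurent_symD.
Qed.

Lemma claurent_symB F G u : symbol F -> symbol G -> l2 u ->
  claurent (fun x => F x - G x) u = fun n => claurent F u n - claurent G u n.
Proof.
move=> sF sG /l2P[ur ui]; apply: seqZ_eq; rewrite ?reSB ?imSB; exact: laurent_symB.
Qed.

Lemma claurent_symZ (c : R) F u : symbol F -> l2 u ->
  claurent (fun x => c * F x) u = fun n => c%:C * claurent F u n.
Proof.
move=> sF /l2P[ur ui]; apply: seqZ_eq; rewrite ?reSZ ?imSZ; exact: laurent_symZ.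
Qed.

Lemma claurent_cosM (k : int) u n : l2 u ->
  claurent (fun x => cos (k%:~R * x)) u n = 2%:R^-1 * (u (n - k) + u (n + k)).
Proof.
move=> /l2P[ur ui]; rewrite /claurent !laurent_cosM1 //.
rewrite /reS /imS; case: (u (n - k)) (u (n + k)) => [x y] [x' y'].
have -> : (2%:R^-1 : R[i]) = (2^-1 : R)%:C by rewrite fmorphV /= rmorph_nat.
by simpc.
Qed.

Lemma Delta_laurent u : l2 u -> Delta u = claurent (@cos R) u.
Proof.
move=> lu; apply/funext => n.
have := claurent_cosM 1 n lu.
have -> : (fun x : R => cos (1%:~R * x)) = @cos R by apply/funext => x; rewrite mul1r.
by move=> ->; rewrite /Delta /shiftZ opprK.
Qed.

Lemma Delta_l2 u : l2 u -> l2 (Delta u).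
Proof. by move=> lu; rewrite Delta_laurent //; apply: claurent_l2 => //; exact: symbol_cos. Qed.

End ComplexSequences.
Arguments l2Z {R} c [u] _.
Arguments rdotZl {R} c [u v] _ _.
Arguments rdotZr {R} c [u v] _ _.
#[export] Hint Resolve l2_re l2_im : core.

(** * The diagonal spectral measures *)

Section FirstMoment.
Context {R : realType}.
Local Open Scope complex_scope.
Variable mu : {finite_measure set (measurableTypeR R) -> \bar R}.
Implicit Types (B : set (measurableTypeR R)) (a b : R).

Lemma ge_moment B a : measurable B -> mu.-integrable B (fun x => (x : R)%:E) ->
  (forall x, B x -> a <= x) -> a * fine (mu B) <= \int[mu]_(x in B) (x : R).
Proof.
move=> mB iB aB; rewrite -Rintegral_cst //; apply: le_Rintegral => //.
exact: finite_measure_integrable_cst.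
Qed.

Lemma le_moment B b : measurable B -> mu.-integrable B (fun x => (x : R)%:E) ->
  (forall x, B x -> x <= b) -> \int[mu]_(x in B) (x : R) <= b * fine (mu B).
Proof.
move=> mB iB aB; rewrite -Rintegral_cst //; apply: le_Rintegral => //.
exact: finite_measure_integrable_cst.
Qed.

Lemma moment_carrier B : measurable B -> mu (~` B) = 0%E ->
  mu.-integrable setT (fun x => (x : R)%:E) ->
  \int[mu]_x (x : R) = \int[mu]_(x in B) (x : R).
Proof.
move=> mB B0 i1; have mC := measurableC mB.
rewrite /Rintegral; congr fine.
rewrite (negligible_integral mC measurableT i1 B0).
by congr integral; rewrite setDE setCK setTI.
Qed.

Lemma moment_integrable B c : measurable B -> (forall x, B x -> `|x| <= c) ->
  mu.-integrable B (fun x => (x : R)%:E).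
Proof.
move=> mB Bc; apply: measurable_bounded_integrable => //.
- by rewrite -ge0_fin_numE // fin_num_measure.
- by exists c; split; [exact: num_real|move=> N cN x Bx; exact: le_trans (Bc x Bx) (ltW cN)].
Qed.

End FirstMoment.

Section SpectralMeasure.
Context {R : realType}.
Local Open Scope complex_scope.
Implicit Types (u v : seqZ R) (B : set (measurableTypeR R)).

Definition specproj (B : set R) : oper R := claurent (icos B).

Lemma icos0 : icos (set0 : set R) = fun=> 0.
Proof. by apply/funext => x; rewrite /icos indic0. Qed.

Lemma specprojI B B' u : measurable B -> measurable B' -> l2 u ->
  specproj (B `&` B') u = specproj B (specproj B' u).
Proof.
move=> mB mB' lu; rewrite /specproj (funext (icosI B B')) claurentM //.
  exact: mult_icos.
exact: symbol_icos.
Qed.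

Lemma specproj_orth B : measurable B -> orth_projection (specproj B).
Proof.
move=> mB; have sB := symbol_icos mB; split.
- exact: claurent_bounded.
- by move=> u lu; rewrite -specprojI // setIid.
- by move=> u v lu lv; exact: claurent_sym.
Qed.

Lemma specproj_mass B u : measurable B -> l2 u ->
  rdot u (specproj B u) = rdot (specproj B u) (specproj B u).
Proof.
move=> mB lu; have sB := symbol_icos mB.
have lB := claurent_l2 sB lu.
have E : specproj B (specproj B u) = specproj B u by rewrite -specprojI // setIid.
by rewrite -{1}E; exact: esym (claurent_rsym sB lu lB).
Qed.

(** The value 0 on non-Borel sets makes nonnegativity hold for all sets. The
    proof argument records for which vectors this is a measure. *)
Definition specmeas u (lu : l2 u) : set (measurableTypeR R) -> \bar R :=
  fun B => if `[<measurable B>] then (rdot u (specproj B u))%:E else 0%E.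

Section Measure.
Variables (u : seqZ R) (lu : l2 u).
Notation mu := (specmeas lu).

Lemma specmeasE B : measurable B -> mu B = (rdot u (specproj B u))%:E.
Proof. by move=> mB; rewrite /specmeas asboolT. Qed.

Lemma specmeas0 : mu set0 = 0%E.
Proof.
rewrite specmeasE // /specproj icos0 claurent_cst //.
by rewrite (rdotZr 0 lu lu) mul0r.
Qed.

Lemma specmeas_ge0 B : (0 <= mu B)%E.
Proof.
rewrite /specmeas; case: asboolP => // mB; rewrite lee_fin specproj_mass //.
by apply: rdot_ge0; apply: claurent_l2 => //; exact: symbol_icos.
Qed.

(** Finite unions give partial sums of disjoint indicators, hence a bounded
    pointwise convergent sequence of symbols, and weak convergence of the
    operators is convergence of the measures. *)
Lemma specmeas_sigma_additive : semi_sigma_additive mu.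
Proof.
move=> F mF tF mU.
have mn n : measurable (\bigcup_(i < n) F i) by apply: bigcup_measurable => i _.
have E n : (\sum_(0 <= i < n) mu (F i))%E = (rdot u (claurent (icos (\bigcup_(i < n) F i)) u))%:E.
  elim: n => [|n IH].
    rewrite big_geq // bigcup_mkord big_ord0 icos0 claurent_cst //.
    by rewrite (rdotZr 0 lu lu) mul0r.
  rewrite big_nat_recr; last by [].
  rewrite IH (specmeasE (mF n)).
  rewrite -[LHS]/((rdot u (specproj (\bigcup_(i < n) F i) u) + rdot u (specproj (F n) u))%:E).
  congr EFin.
  have -> : icos (\bigcup_(i < n.+1) F i) = fun x => icos (\bigcup_(i < n) F i) x + icos (F n) x.
    apply/funext => x; rewrite /icos !indicE.
    have [h|h] := pselect (F n (cos x)).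
      rewrite (mem_set h) mem_set; last by exists n => //=.
      rewrite memNset ?add0r // => -[i /= ltin Fi].
      by have := tF i n I I; move=> /(_ (ex_intro _ _ (conj Fi h))) in_eq; rewrite in_eq ltnn in ltin.
    rewrite (memNset h) addr0; congr (_%:R); congr nat_of_bool.
    apply/idP/idP => /set_mem[i /= ltin Fi]; apply/mem_set; exists i => //=; last exact: ltnW.
    by move: ltin; rewrite ltnS leq_eqVlt => /predU1P[ein|//]; rewrite ein in Fi.
  have sU := symbol_icos (mn n); have sF := symbol_icos (mF n).
  rewrite claurent_symD // rdotDr //; exact: claurent_l2.
rewrite (funext E) (specmeasE mU); apply: cvg_EFin; first exact: nearW.
have [ur ui] := (l2P u).1 lu.
apply: cvgD; apply: (@laurent_weak_cvg _ 1 (fun n => icos (\bigcup_(i < n) F i))) => //.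
- by move=> n; exact: symbol_icos.
- by move=> n; exact: icos_bounded.
- exact: symbol_icos.
- by move=> x; exact: icos_bigcup.
- by move=> n; exact: symbol_icos.
- by move=> n; exact: icos_bounded.
- exact: symbol_icos.
- by move=> x; exact: icos_bigcup.
Qed.

HB.instance Definition _ := isMeasure.Build _ _ _ mu
  specmeas0 specmeas_ge0 specmeas_sigma_additive.

Lemma specmeas_fin : fin_num_fun mu.
Proof. by move=> B mB; rewrite specmeasE. Qed.

HB.instance Definition _ := @Measure_isFinite.Build _ _ _ mu specmeas_fin.

End Measure.

End SpectralMeasure.

(** * The first moment and the spectral measure of the Laplacian *)

Section Existence.
Context {R : realType}.
Local Open Scope complex_scope.
Implicit Types (u v : seqZ R) (B : set (measurableTypeR R)).

Section Moment.
Variables (u : seqZ R) (lu : l2 u).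
Let mu : {finite_measure set (measurableTypeR R) -> \bar R} := specmeas lu.
Let mass B : R := fine (mu B).
Let defect B : R :=
  \int[mu]_(x in B) (x : R) - rdot u (claurent (fun x => cos x * icos B x) u).

Let massE B : measurable B -> mass B = rdot (specproj B u) (specproj B u).
Proof. by move=> mB; rewrite /mass /mu /= specmeasE //= specproj_mass. Qed.

Let symbol_cosicos B : measurable B -> symbol (fun x : R => cos x * icos B x).
Proof. by move=> mB; apply: symbolM; [exact: symbol_cos|exact: symbol_icos]. Qed.

(** On a Borel set contained in an interval of length [L] starting at [c], both
    the integral of the identity and the form of the localized operator are
    within [L * mass] of [c * mass]. *)
Let defect_small B (c L : R) : measurable B -> 0 <= L ->
  (forall x, B x -> c <= x <= c + L) -> `|defect B| <= 2 * L * mass B.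
Proof.
move=> mB L0 Bc.
have sB := symbol_icos mB; have [_ pB] := mult_icos mB.
have mass0 : 0 <= mass B by rewrite fine_ge0.
have iB : mu.-integrable B (fun x => (x : R)%:E).
  apply: (@moment_integrable _ _ _ (`|c| + L)) => // x /Bc /andP[cx xc].
  rewrite ler_norml; have := ler_norm c; have := ler_norm (- c); rewrite normrN => h1 h2.
  by apply/andP; split; lra.
have h1 := ge_moment mB iB (fun x Bx => (andP (Bc x Bx)).1).
have h2 := le_moment mB iB (fun x Bx => (andP (Bc x Bx)).2).
pose H x : R := (cos x - c) * icos B x.
have mH : mult_symbol H.
  apply: multM; last exact: mult_icos.
  by apply: multB; [exact: mult_cos|exact: mult_cst].
have sH : symbol H by case: mH.
have bH : bounded_by L H.
  move=> x; rewrite /H /icos indicE.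
  have [h|h] := pselect (B (cos x)); last by rewrite memNset // mulr0 normr0.
  rewrite mem_set // mulr1; have /andP[h3 h4] := Bc _ h; rewrite ger0_norm; lra.
set w := specproj B u.
have lw : l2 w by apply: claurent_l2.
have idB x : icos B x * icos B x = icos B x by rewrite -icosI setIid.
have E1 : claurent H u = claurent H w.
  rewrite /w /specproj -(claurentM mH sB lu); congr (claurent _ u); apply/funext => x.
  by rewrite /H -mulrA idB.
have E2 : claurent H w = specproj B (claurent H w).
  rewrite /specproj -(claurentM (mult_icos mB) sH lw).
  by congr (claurent _ w); apply/funext => x; rewrite /H mulrCA idB.
have lHw : l2 (claurent H w) by apply: claurent_l2.
have E3 : rdot u (claurent (fun x => cos x * icos B x) u) - c * mass B = rdot w (claurent H w).
  have sC := symbol_cosicos mB.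
  have lC := claurent_l2 sC lu; have lB := claurent_l2 sB lu.
  rewrite (massE mB) -(specproj_mass mB lu) /specproj.
  rewrite -(rdotZr c lu lB) -(rdotBr lu lC (l2Z c lB)).
  have EH : claurent H u = fun n => claurent (fun x => cos x * icos B x) u n - c%:C * claurent (icos B) u n.
    have -> : H = fun x => cos x * icos B x - c * icos B x by apply/funext => x; rewrite /H mulrBl.
    by rewrite (claurent_symB sC (symbolZ c sB) lu) (claurent_symZ c sB lu).
  rewrite -EH.
  by rewrite E1 {1}E2; exact: esym (claurent_rsym sB lu lHw).
have h3 : `|rdot w (claurent H w)| <= L * mass B.
  rewrite -(ler_pXn2r (n := 2)) ?nnegrE ?mulr_ge0 //.
  rewrite -normrX ger0_norm ?sqr_ge0 //; apply: le_trans (rdot_CS lw lHw) _.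
  rewrite exprMn massE // mulrC expr2 -/w [leRHS]mulrA; apply: ler_wpM2r; first exact: rdot_ge0.
  exact: claurent_rdot_le.
rewrite /defect.
have := ler_norm (rdot w (claurent H w)); have := ler_norm (- rdot w (claurent H w)).
rewrite normrN => h4 h5.
rewrite -/(mass B) in h1 h2; rewrite ler_norml; apply/andP; split; lra.
Qed.

Let defectU B B' (c : R) : measurable B -> measurable B' ->
  (forall x, (B `|` B') x -> `|x| <= c) -> [disjoint B & B'] ->
  defect (B `|` B') = defect B + defect B' /\ mass (B `|` B') = mass B + mass B'.
Proof.
move=> mB mB' Bc dB; have mU := measurableU _ _ mB mB'.
have E x : icos (B `|` B') x = icos B x + icos B' x.
  rewrite /icos !indicE; have [h|h] := pselect (B (cos x)).
    rewrite (mem_set h) mem_set; last by left.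
    rewrite memNset ?addr0 // => h'.
    by move/disj_setPS : dB => /(_ (cos x)); apply.
  rewrite (memNset h) add0r; congr (_%:R); congr nat_of_bool.
  by apply/idP/idP => /set_mem h'; apply/mem_set; [case: h'|right].
split.
  rewrite /defect Rintegral_setU //; last exact: moment_integrable Bc.
  have -> : (fun x => cos x * icos (B `|` B') x) = fun x => cos x * icos B x + cos x * icos B' x.
    by apply/funext => x; rewrite E mulrDr.
  have s1 := symbol_cosicos mB; have s2 := symbol_cosicos mB'.
  rewrite (claurent_symD s1 s2 lu) (rdotDr lu (claurent_l2 s1 lu) (claurent_l2 s2 lu)).
  by rewrite opprD addrACA.
rewrite /mass -fineD ?fin_num_measure // measureU //.
exact/disj_set2P.
Qed.

(** The defect is additive and bounded by length times mass, so each halving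
    of the intervals halves the bound. *)
Let defect_halving n (c L : R) : 0 <= L ->
  `|defect (`[c, c + L[%classic)| <= 2 * (L / 2 ^+ n) * mass (`[c, c + L[%classic).
Proof.
elim: n c L => [|n IH] c L L0.
  have mI : measurable (`[c, c + L[%classic : set (measurableTypeR R)) by exact: measurable_itv.
  rewrite expr0 divr1; apply: (@defect_small _ c _ mI L0).
  by move=> x /=; rewrite in_itv /= => /andP[-> /ltW].
have L2 : 0 <= L / 2 by rewrite divr_ge0.
have -> : c + L = c + L / 2 + L / 2 by field.
pose B := `[c, c + L / 2[%classic : set R; pose B' := `[c + L / 2, c + L / 2 + L / 2[%classic : set R.
have EU : `[c, c + L / 2 + L / 2[%classic = B `|` B'.
  apply/seteqP; split=> x; rewrite /= in_itv /=.
    move=> /andP[h1 h2]; have [h3|h3] := ltP x (c + L / 2).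
      by left; rewrite /B /= in_itv /= h1.
    by right; rewrite /B' /= in_itv /= h2 andbT.
  by case; rewrite /B /B' /= in_itv /= => /andP[h1 h2]; apply/andP; split; lra.
rewrite EU; have [||||-> ->] := @defectU B B' (`|c| + L).
- exact: measurable_itv.
- exact: measurable_itv.
- move=> x; rewrite -EU /= in_itv /= => /andP[h1 h2]; rewrite ler_norml.
  have := ler_norm c; have := ler_norm (- c); rewrite normrN => h3 h4.
  by apply/andP; split; lra.
- apply/disj_setPS => x []; rewrite /B /B' /= !in_itv /= => /andP[_ h1] /andP[h2 _]; lra.
have h1 : `|defect B| <= 2 * (L / 2 / 2 ^+ n) * mass B := IH c _ L2.
have h2 : `|defect B'| <= 2 * (L / 2 / 2 ^+ n) * mass B' := IH (c + L / 2) _ L2.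
have Ln : L / 2 / 2 ^+ n = L / 2 ^+ n.+1 by rewrite exprS; field; rewrite expf_neq0.
rewrite Ln in h1 h2; move: (defect B) (defect B') (mass B) (mass B') (L / _) h1 h2.
by move=> d d' m m' l h1 h2; apply: le_trans (ler_normD _ _) _; rewrite mulrDr lerD.
Qed.

(** The first moment reproduces the quadratic form of the operator: the
    difference of the two, the defect, vanishes on an interval that contains the
    spectrum. *)
Lemma specmeas_moment :
  mu.-integrable setT (fun x => (x : R)%:E) /\ rdot u (claurent (@cos R) u) = \int[mu]_x (x : R).
Proof.
(* Any half-open interval that contains the spectrum would do. *)
pose B := `[-1, -1 + 4[%classic : set R.
have mB : measurable (B : set (measurableTypeR R)) by exact: measurable_itv.
have BE x : icos B x = 1.
  rewrite /icos indicE mem_set // /B /= in_itv /=.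
  by have := cos_le1 x; have := cos_geN1 x => h1 h2; apply/andP; split; lra.
have C0 : mu (~` B) = 0%E.
  rewrite /mu /= specmeasE; last exact: measurableC.
  rewrite /specproj (_ : icos (~` B) = fun=> 0); last first.
    by apply/funext => x; rewrite icosC BE subrr.
  by rewrite claurent_cst // (rdotZr 0 lu lu) mul0r.
have i1 : mu.-integrable setT (fun x => (x : R)%:E).
  apply/(negligible_integrable (measurableC mB) measurableT _ C0).
    by apply/measurable_EFinP; exact: measurable_id.
  rewrite setTD setCK; apply: (@moment_integrable _ _ _ 3) => // x; rewrite /B /=.
  by rewrite in_itv /= => /andP[h1 h2]; rewrite ler_norml; apply/andP; split; lra.
split => //; apply/esym; rewrite (moment_carrier mB C0 i1).
have -> : @cos R = (fun x => cos x * icos B x) by apply/funext => x; rewrite BE mulr1.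
apply/eqP; rewrite -subr_eq0 -/(defect B) -normr_eq0 eq_le normr_ge0 andbT.
have C : (fun n => 2 * (4 / 2 ^+ n) * mass B) @ \oo --> (0 : R).
  have -> : (fun n => 2 * (4 / 2 ^+ n) * mass B) = (fun n => (8 * mass B) * (2^-1) ^+ n).
    by apply/funext => n; rewrite exprVn; ring.
  rewrite -(mulr0 (8 * mass B)); apply: cvgMr; apply: cvg_expr.
  by rewrite ger0_norm ?invr_ge0 // invf_lt1 // ltr1n.
rewrite -(cvg_lim _ C) //; apply: limr_ge; first exact: cvgP C.
by apply: nearW => n; exact: defect_halving.
Qed.

End Moment.

(** The product rule for indicators makes these operators commuting projections;
    the diagonal measures and their first moments supply the rest. *)
Theorem specproj_Delta : spectral_measure_of (@Delta R) specproj.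
Proof.
split.
- exact: specproj_orth.
- exists 1 => u lu; rewrite /specproj (_ : icos _ = fun=> 1) ?claurent1 //.
  apply/funext => x; rewrite /icos indicE mem_set //= in_itv /=.
  by rewrite cos_geN1 cos_le1.
- by move=> B B' mB mB' u lu; exact: specprojI.
- move=> u lu; exists (specmeas lu); have [i1 E] := specmeas_moment lu.
  split=> //.
    move=> B mB; apply: etrans (specmeasE lu mB) _; rewrite Re_inner //.
    by apply: claurent_l2 => //; exact: symbol_icos.
  rewrite -E Delta_laurent //; apply: claurent_inner_real => //; exact: symbol_cos.
Qed.

(** The spectral projections are specified by a choice among all spectral
    measures, so what follows is deduced from the defining properties alone. *)
Lemma spectral_projection_Delta :
  spectral_measure_of (@Delta R) (spectral_projection (@Delta R)).
Proof.
rewrite /spectral_projection.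
have := @xgetPex _ (fun _ _ _ => 0 : R[i]) [set E : set R -> seqZ R -> seqZ R |
  spectral_measure_of (@Delta R) E].
by apply; exists specproj; exact: specproj_Delta.
Qed.

End Existence.

(** * Spectral subspaces of an operator with a spectral measure *)

Section BoundedOperators.
Context {R : realType}.
Local Open Scope complex_scope.
Implicit Types (T : oper R) (u v : seqZ R).

Lemma op_l2 T u : bounded_op T -> l2 u -> l2 (T u).
Proof. by case=> Tl2 _ _; exact: Tl2. Qed.

Lemma opD T u v : bounded_op T -> l2 u -> l2 v ->
  T (fun n => u n + v n) = fun n => T u n + T v n.
Proof.
move=> [_ TL _] lu lv; have := TL 1 u v lu lv.
have -> : (fun n => 1 * u n + v n) = fun n => u n + v n by apply/funext => n; rewrite mul1r.
by move=> ->; apply/funext => n; rewrite mul1r.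
Qed.

Lemma opB T u v : bounded_op T -> l2 u -> l2 v ->
  T (fun n => u n - v n) = fun n => T u n - T v n.
Proof.
move=> [_ TL _] lu lv; have := TL (-1) v u lv lu.
have -> : (fun n => -1 * v n + u n) = fun n => u n - v n.
  by apply/funext => n; rewrite mulN1r addrC.
by move=> ->; apply/funext => n; rewrite mulN1r addrC.
Qed.

Lemma opZ T (c : R) u : bounded_op T -> l2 u ->
  T (fun n => c%:C * u n) = fun n => c%:C * T u n.
Proof.
move=> bT lu; have [_ TL _] := bT; have := TL c%:C u (fun=> 0) lu l2_0.
have -> : (fun n => c%:C * u n + 0) = fun n => c%:C * u n by apply/funext => n; rewrite addr0.
have -> : T (fun=> 0) = fun=> 0.
  have := opB bT lu lu; have -> : (fun n => u n - u n) = fun=> 0 by apply/funext => n; rewrite subrr.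
  by move=> ->; apply/funext => n; rewrite subrr.
by move=> ->; apply/funext => n; rewrite addr0.
Qed.

Lemma rdot0l u : l2 u -> rdot (fun=> 0) u = 0.
Proof.
move=> lu; rewrite -[RHS](mul0r (rdot u u)) -(rdotZl 0 lu lu); congr rdot.
by apply/funext => n; rewrite mul0r.
Qed.

Lemma rdot0r u : l2 u -> rdot u (fun=> 0) = 0.
Proof. by move=> lu; rewrite rdotC rdot0l. Qed.

End BoundedOperators.
Arguments opZ {R} [T] c [u] _ _.

Section SpectralMeasures.
Context {R : realType}.
Local Open Scope complex_scope.
Variables (T : oper R) (E : set R -> oper R).
Hypotheses (bT : bounded_op T)
  (symT : forall u v, l2 u -> l2 v -> rdot (T u) v = rdot u (T v))
  (hE : spectral_measure_of T E).
Implicit Types (u v w y : seqZ R) (B I : set (measurableTypeR R)) (a b d : R).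

Let lT u : l2 u -> l2 (T u) := op_l2 bT.

Let bE B : measurable B -> bounded_op (E B).
Proof. by case: hE => oE _ _ _ mB; case: (oE B mB). Qed.

Let lE B u : measurable B -> l2 u -> l2 (E B u).
Proof. by move=> mB; exact/op_l2/bE. Qed.

Let symE B u v : measurable B -> l2 u -> l2 v -> rdot (E B u) v = rdot u (E B v).
Proof.
case: hE => oE _ _ _ mB lu lv; have [_ _ S] := oE B mB.
by rewrite -!Re_inner ?S //; exact: lE.
Qed.

Let EI B B' u : measurable B -> measurable B' -> l2 u -> E (B `&` B') u = E B (E B' u).
Proof. by case: hE => _ _ EI _ mB mB' lu; exact: EI. Qed.

Let EE B u : measurable B -> l2 u -> E B (E B u) = E B u.
Proof. by move=> mB lu; rewrite -EI // setIid. Qed.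

Let ET u : l2 u -> E setT u = u.
Proof.
case: hE => _ [M EM] _ _ lu.
by rewrite -[in LHS](EM u lu) -EI ?setTI ?EM //; exact: measurable_itv.
Qed.

Let moment u : l2 u -> exists mu : {finite_measure set (measurableTypeR R) -> \bar R},
  [/\ forall B, measurable B -> mu B = (rdot u (E B u))%:E,
      mu.-integrable setT (fun x => (x : R)%:E) &
      rdot u (T u) = \int[mu]_x (x : R)].
Proof.
case: hE => _ _ _ H lu; have [mu [h1 h2 h3]] := H u lu; exists mu; split => //.
  by move=> B mB; rewrite h1 // Re_inner //; exact: lE.
by rewrite -Re_inner ?h3 //; exact: lT.
Qed.

Let E0 u : l2 u -> E set0 u = fun=> 0.
Proof.
move=> lu; have m0 : measurable (set0 : set (measurableTypeR R)) by exact: measurable0.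
have [mu [h1 _ _]] := moment lu.
apply: rdot_eq0; first exact: lE.
rewrite symE // ?EE //; last exact: lE.
by have := h1 _ m0; rewrite measure0 => -[<-].
Qed.

(** The diagonal measure of [v + w] is the sum of those of [v] and [w] when
    [E I] separates the two, so the first moments add up and the cross term of
    the quadratic form of [T] vanishes. *)
Lemma spectral_orth I v w : measurable I -> l2 v -> l2 w ->
  E I v = (fun=> 0) -> E I w = w -> rdot v (T w) = 0.
Proof.
move=> mI lv lw Ev Ew.
have lvw := l2D lv lw.
have cross B : measurable B -> rdot v (E B w) = 0.
  move=> mB; have lB := lE mB lw.
  by rewrite -Ew -EI // setIC EI // -symE // Ev rdot0l.
have [mv [mvE mvi mvT]] := moment lv.
have [mw [mwE mwi mwT]] := moment lw.
have [ms [msE msi msT]] := moment lvw.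
have msum B : measurable B -> B `<=` setT -> ms B = measure_add mv mw B.
  move=> mB _; rewrite measure_addE msE //.
  transitivity ((rdot v (E B v))%:E + (rdot w (E B w))%:E)%E; last first.
    by congr (_ + _)%E; apply/esym; [exact: mvE|exact: mwE].
  rewrite -EFinD; congr EFin.
  have lBv := lE mB lv; have lBw := lE mB lw.
  rewrite (opD (bE mB) lv lw) (rdotDl lv lw (l2D lBv lBw)) (rdotDr lv lBv lBw) (rdotDr lw lBv lBw).
  by rewrite cross // -(symE mB lw lv) (rdotC _ v) cross // addr0 add0r.
(* First moments are additive in the measure. *)
have Esum : rdot (fun n => v n + w n) (T (fun n => v n + w n)) = rdot v (T v) + rdot w (T w).
  rewrite msT mvT mwT /Rintegral (eq_measure_integral (measure_add mv mw)) //.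
  rewrite integral_measure_add // fineD //; exact: integrable_fin_num.
have lTv := lT lv; have lTw := lT lw.
move: Esum; rewrite (opD bT lv lw) (rdotDl lv lw (l2D lTv lTw)) (rdotDr lv lTv lTw) (rdotDr lw lTv lTw).
by rewrite -(symT lw lv) (rdotC (T w)); lra.
Qed.

(** The range of [E I] is invariant, because its complement is orthogonal to
    [T w] for [w] in the range. *)
Lemma spectral_invariant I w : measurable I -> l2 w -> E I w = w -> E I (T w) = T w.
Proof.
move=> mI lw Ew; have lTw := lT lw; have lETw := lE mI lTw.
pose v n := T w n - E I (T w) n.
have lv : l2 v := l2B lTw lETw.
have Ev : E I v = fun=> 0.
  rewrite /v (opB (bE mI) lTw lETw) EE //; apply/funext => n; exact: subrr.
have v0 : v = fun=> 0.
  apply: rdot_eq0 => //.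
  have -> : rdot v v = rdot v (T w) - rdot v (E I (T w)) := rdotBr lv lTw lETw.
  by rewrite (spectral_orth mI lv lw Ev Ew) -symE // Ev rdot0l // subrr.
by apply/funext => n; have := congr1 (fun f => f n) v0; rewrite /v => /subr0_eq.
Qed.

(** If the projection of the complement does not see [y], the diagonal measure
    of [y] lives on [B]; this is the form in which localization enters the two
    bounds below. *)
Let carrier_mass y B (mu : {finite_measure set (measurableTypeR R) -> \bar R}) :
  measurable B -> l2 y -> (forall B, measurable B -> mu B = (rdot y (E B y))%:E) ->
  rdot y (E (~` B) y) = 0 -> mu (~` B) = 0%E /\ fine (mu B) = rdot y y.
Proof.
move=> mB ly muE C0; have mC := measurableC mB.
have muC : mu (~` B) = 0%E by rewrite muE // C0.
split=> //; have := muE setT (measurableT : measurable (setT : set (measurableTypeR R))).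
rewrite ET // => muT; rewrite -[RHS]/(fine (rdot y y)%:E) -muT; congr fine.
have -> : mu setT = (mu B + mu (~` B))%E.
  by rewrite -[X in mu X](setUv B); apply: measureU => //; exact: setICr.
by rewrite muC adde0.
Qed.

Lemma spectral_form_ge B a y : measurable B -> l2 y -> rdot y (E (~` B) y) = 0 ->
  (forall x, B x -> a <= x) -> a * rdot y y <= rdot y (T y).
Proof.
move=> mB ly C0 Ba; have [mu [muE mui ->]] := moment ly.
have [muC <-] := carrier_mass mB ly muE C0.
rewrite (moment_carrier mB muC mui); apply: ge_moment => //.
by apply: integrableS mui.
Qed.

Lemma spectral_form_le B b y : measurable B -> l2 y -> rdot y (E (~` B) y) = 0 ->
  (forall x, B x -> x <= b) -> rdot y (T y) <= b * rdot y y.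
Proof.
move=> mB ly C0 Ba; have [mu [muE mui ->]] := moment ly.
have [muC <-] := carrier_mass mB ly muE C0.
rewrite (moment_carrier mB muC mui); apply: le_moment => //.
by apply: integrableS mui.
Qed.

Let range_carrier B w : measurable B -> l2 w -> E B w = w -> rdot w (E (~` B) w) = 0.
Proof.
move=> mB lw Ew; have mC := measurableC mB.
by rewrite -{2}Ew -EI // setICl E0 // rdot0r.
Qed.

Let S (x : R) u : seqZ R := fun n => T u n - x%:C * u n.

Let lS x u : l2 u -> l2 (S x u).
Proof. by move=> lu; apply: l2B; [exact: lT|exact: l2Z]. Qed.

Arguments lS x [u] _.

Let rdotS x u v : l2 u -> l2 v -> rdot u (S x v) = rdot u (T v) - x * rdot u v.
Proof. by move=> lu lv; rewrite /S (rdotBr lu (lT lv) (l2Z x lv)) (rdotZr x lu lv). Qed.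

Let symS x u v : l2 u -> l2 v -> rdot (S x u) v = rdot u (S x v).
Proof. by move=> lu lv; rewrite rdotC !rdotS // -symT // (rdotC v) (rdotC (T v)). Qed.

(** On the range of the projection of an interval of radius [d] about [x], the
    form of [T - x] is bounded by [d]; since the range is invariant,
    polarization with the vector [(T - x) w] turns this into a norm bound. *)
Lemma spectral_norm_le (x d : R) w : 0 <= d -> l2 w -> E `]x - d, x + d[ w = w ->
  rdot (S x w) (S x w) <= d ^+ 2 * rdot w w.
Proof.
move=> d0 lw Ew; set I := `]x - d, x + d[%classic in Ew.
have mI : measurable (I : set (measurableTypeR R)) by exact: measurable_itv.
have form y : l2 y -> E I y = y -> `|rdot y (S x y)| <= d * rdot y y.
  move=> ly Ey; have C0 := range_carrier mI ly Ey.
  have h1 : (x - d) * rdot y y <= rdot y (T y).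
    by apply: spectral_form_ge C0 _ => // z; rewrite /I /= in_itv /= => /andP[/ltW].
  have h2 : rdot y (T y) <= (x + d) * rdot y y.
    by apply: spectral_form_le C0 _ => // z; rewrite /I /= in_itv /= => /andP[_ /ltW].
  by rewrite rdotS // ler_norml; apply/andP; split; lra.
(* Polarize between multiples of [z = (T - x) w] and [w]; the weight of [z]
   is then optimized by the discriminant criterion. *)
set z := S x w; have lz : l2 z := lS x lw.
have Ez : E I z = z.
  rewrite /z /S (opB (bE mI) (lT lw) (l2Z x lw)) (opZ x (bE mI) lw) Ew.
  by rewrite spectral_invariant.
have z0 := rdot_ge0 lz; have w0 := rdot_ge0 lw.
have key : rdot z z ^+ 2 <= d ^+ 2 * rdot z z * rdot w w.
  apply: discr_le => // s.
  have lsz := l2Z s lz; have lp := l2D lsz lw; have lm := l2B lsz lw.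
  have Esz : E I (fun n => s%:C * z n) = fun n => s%:C * z n by rewrite (opZ s (bE mI) lz) Ez.
  have Ep := opD (bE mI) lsz lw; rewrite Esz Ew in Ep.
  have Em := opB (bE mI) lsz lw; rewrite Esz Ew in Em.
  have hp := le_trans (ler_norm _) (form _ lp Ep).
  have := ler_norm (- rdot (fun n => s%:C * z n - w n) (S x (fun n => s%:C * z n - w n))).
  rewrite normrN => /le_trans /(_ (form _ lm Em)) hm.
  have lSz := lS x lsz; have lSw := lS x lw.
  have SD : S x (fun n => s%:C * z n + w n) = fun n => S x (fun n => s%:C * z n) n + S x w n.
    by rewrite /S (opD bT lsz lw); apply/funext => n; ring.
  have SB : S x (fun n => s%:C * z n - w n) = fun n => S x (fun n => s%:C * z n) n - S x w n.
    by rewrite /S (opB bT lsz lw); apply/funext => n; ring.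
  move: hp hm; rewrite SD SB.
  rewrite (rdotDl lsz lw (l2D lSz lSw)) (rdotDr lsz lSz lSw) (rdotDr lw lSz lSw).
  rewrite (rdotBl lsz lw (l2B lSz lSw)) (rdotBr lsz lSz lSw) (rdotBr lw lSz lSw).
  rewrite (rdotDl lsz lw lp) (rdotDr lsz lsz lw) (rdotDr lw lsz lw).
  rewrite (rdotBl lsz lw lm) (rdotBr lsz lsz lw) (rdotBr lw lsz lw).
  rewrite -(symS x lw lsz) (rdotC (S x w)) (rdotC w (fun n => s%:C * z n)).
  rewrite (rdotZl s lz lSw) (rdotZl s lz lsz) (rdotZr s lz lz) -/z.
  move: (rdot (fun n => s%:C * z n) (S x _)) (rdot w z) (rdot (fun n => s%:C * z n) w).
  move: (rdot z z) (rdot w w) => *; lra.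
have [->|zn0] := eqVneq (rdot z z) 0; first by rewrite mulr_ge0 // sqr_ge0.
move: key; rewrite expr2 mulrAC ler_pM2r // lt_neqAle eq_sym zn0 //.
Qed.

(** If the projection of an interval about [x] vanished, then [T - x] would be
    bounded below by its radius: the spectral subspaces above and below the
    interval are orthogonal and invariant, and the form of [T - x] is at least
    [d] on the first and at most [- d] on the second. *)
Lemma spectral_nonzero (x d : R) u : 0 < d -> l2 u ->
  rdot (S x u) (S x u) < d ^+ 2 * rdot u u ->
  exists w, [/\ l2 w, E `]x - d, x + d[ w = w & 0 < rdot w w].
Proof.
move=> d0 lu Su; set J := `]x - d, x + d[%classic.
have mJ : measurable (J : set (measurableTypeR R)) by exact: measurable_itv.
apply: contrapT => noW.
have EJ y : l2 y -> E J y = fun=> 0.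
  move=> ly; apply: rdot_eq0; first exact: lE.
  rewrite leNgt; apply/negP => h; apply: noW; exists (E J y).
  by split=> //; [exact: lE|exact: EE].
pose U : set (measurableTypeR R) := `[x + d, +oo[%classic.
have mU : measurable U by exact: measurable_itv.
pose p := E U u; pose m n := u n - p n.
have lp : l2 p := lE mU lu; have lm : l2 m := l2B lu lp.
have Ep : E U p = p by exact: EE.
have Em : E U m = fun=> 0.
  by rewrite /m (opB (bE mU) lu lp) Ep; apply/funext => n; exact: subrr.
have up : u = fun n => p n + m n by apply/funext => n; rewrite /m addrC subrK.
have pm0 : rdot p m = 0 by rewrite -Ep symE // Em rdot0r.
have mTp : rdot m (T p) = 0 := spectral_orth mU lm lp Em Ep.
pose V : set (measurableTypeR R) := `]-oo, x - d]%classic.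
have mV : measurable V by exact: measurable_itv.
have VC : ~` V = J `|` U.
  apply/seteqP; split=> z; rewrite /V /U /J /= !in_itv /= ?andbT.
    move=> /negP; rewrite -ltNge => h; have [h2|h2] := ltP z (x + d); last by right.
    by left; rewrite h.
  by move=> h; apply/negP; rewrite -ltNge; case: h => [/andP[]//|]; lra.
have Cm : rdot m (E (~` V) m) = 0.
  have [mu [muE _ _]] := moment lm.
  have muJ : mu J = 0%E by rewrite muE // EJ // rdot0r.
  have muU : mu U = 0%E by rewrite muE // Em rdot0r.
  have JU0 : J `&` U = set0.
    apply/seteqP; split=> // z; rewrite /U /J /= !in_itv /= => -[/andP[_ h1] /andP[h2 _]]; lra.
  have : mu (~` V) = 0%E.
    rewrite VC; have -> : mu (J `|` U) = (mu J + mu U)%E by exact: measureU.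
    by rewrite muJ muU adde0.
  by rewrite muE; [case|exact: measurableC].
have fp : (x + d) * rdot p p <= rdot p (T p).
  apply: spectral_form_ge (range_carrier mU lp Ep) _ => // z.
  by rewrite /U /= in_itv /= andbT.
have fm : rdot m (T m) <= (x - d) * rdot m m.
  by apply: spectral_form_le Cm _ => // z; rewrite /V /= in_itv.
have lq := l2B lp lm; have lSp := lS x lp; have lSm := lS x lm; have lSu := lS x lu.
have Spm : S x u = fun n => S x p n + S x m n.
  by rewrite [in LHS]up /S (opD bT lp lm); apply/funext => n; ring.
have pTm : rdot p (T m) = 0 by rewrite -symT // rdotC.
(* The vector [p - m] has the norm of [u], and the sign change makes both
   diagonal forms positive. *)
have uu : rdot u u = rdot p p + rdot m m.
  rewrite up (rdotDl lp lm (l2D lp lm)) (rdotDr lp lp lm) (rdotDr lm lp lm) (rdotC m p) pm0; lra.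
have qq : rdot (fun n => p n - m n) (fun n => p n - m n) = rdot u u.
  rewrite uu (rdotBl lp lm lq) (rdotBr lp lp lm) (rdotBr lm lp lm) (rdotC m p) pm0; lra.
have qS : d * rdot u u <= rdot (fun n => p n - m n) (S x u).
  rewrite Spm (rdotBl lp lm (l2D lSp lSm)) (rdotDr lp lSp lSm) (rdotDr lm lSp lSm).
  rewrite !rdotS // (rdotC m p) pm0 mTp pTm uu; lra.
have CS := rdot_CS lq lSu; rewrite qq in CS.
have u0 := rdot_ge0 lu; have S0 := rdot_ge0 lSu.
have up0 : 0 < rdot u u.
  by rewrite lt_neqAle u0 andbT eq_sym; apply/eqP => h; move: Su; rewrite h mulr0; lra.
have : (d * rdot u u) ^+ 2 <= rdot u u * rdot (S x u) (S x u).
  apply: le_trans CS; rewrite ler_pXn2r ?nnegrE //.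
    by rewrite mulr_ge0 // ltW.
  by apply: le_trans qS; rewrite mulr_ge0 // ltW.
rewrite exprMn [rdot u u ^+ 2]expr2 mulrA mulrC ler_pM2l //.
by move=> h; have := lt_le_trans Su h; rewrite ltxx.
Qed.

End SpectralMeasures.

(** * The spectrum of the Laplacian *)

Section Spectrum.
Context {R : realType}.
Local Open Scope complex_scope.
Implicit Types (u v w : seqZ R) (x d : R).

Definition shiftop x u : seqZ R := fun n => Delta u n - x%:C * u n.

Lemma symbol_cosB x : symbol (fun t : R => cos t - x).
Proof. by apply: symbolB; [exact: symbol_cos|exact: symbol_cst]. Qed.

Lemma shiftopE x u : l2 u -> shiftop x u = claurent (fun t => cos t - x) u.
Proof.
move=> lu; rewrite claurent_symB //; [|exact: symbol_cos|exact: symbol_cst].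
by rewrite /shiftop Delta_laurent // claurent_cst.
Qed.

Lemma Delta_bounded : bounded_op (@Delta R).
Proof.
have [bl bL bM] := claurent_bounded (@symbol_cos R); split.
- by move=> u; exact: Delta_l2.
- by move=> c u v lu lv; rewrite !Delta_laurent ?bL //; exact: l2_lin.
- by have [M H] := bM; exists M => u lu; rewrite Delta_laurent // H.
Qed.

Lemma Delta_sym u v : l2 u -> l2 v -> rdot (Delta u) v = rdot u (Delta v).
Proof. by move=> lu lv; rewrite !Delta_laurent // claurent_rsym //; exact: symbol_cos. Qed.

(** The resolvent is the Laurent operator with symbol [1 / (cos t - x)], which
    is bounded off the interval from -1 to 1. *)
Lemma resolvent_out x : ~~ (-1 <= x <= 1) -> resolvent_at (@Delta R) x.
Proof.
move=> xout.
have [d d0 dP] : exists2 d : R, 0 < d & forall t : R, d <= `|cos t - x|.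
  have [x1|x1] := ltP 1 x.
    exists (x - 1) => [|t]; first by rewrite subr_gt0.
    rewrite distrC; apply: le_trans (ler_norm _); have := cos_le1 t; lra.
  have x2 : x < -1 by rewrite ltNge; apply: contra xout => ->.
  exists (- 1 - x) => [|t]; first by rewrite subr_gt0.
  by apply: le_trans (ler_norm _); have := cos_geN1 t; lra.
have nz t : cos t - x != 0 by rewrite -normr_gt0; exact: lt_le_trans (dP t).
pose F t := (cos t - x)^-1.
have sF : symbol F.
  apply: (@symbol_continuous _ d^-1).
    move=> t; apply: cvgV => //; apply: cvgB; first exact: continuous_cos.
    exact: cvg_cst.
  by move=> t; rewrite normfV lef_pV2 ?posrE // normr_gt0.
have mG : mult_symbol (fun t : R => cos t - x).
  by apply: multB; [exact: mult_cos|exact: mult_cst].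
have GF : (fun t => (cos t - x) * F t) = fun=> 1 by apply/funext => t; rewrite /F mulfV.
exists (claurent F); split; first exact: claurent_bounded.
move=> u lu; have lF := claurent_l2 sF lu; split.
  rewrite -[X in claurent F X]/(shiftop x u) shiftopE //.
  by rewrite (claurentC mG sF lu) -(claurentM mG sF lu) GF claurent1.
rewrite -[LHS]/(shiftop x (claurent F u)) shiftopE //.
by rewrite -(claurentM mG sF lu) GF claurent1.
Qed.

Lemma avg_gt0 (F : R -> R) (a b : R) : symbol F -> (forall t, 0 <= F t) ->
  a < b -> 0 <= a -> b <= pi -> (forall t, a <= t <= b -> 1 <= F t) -> 0 < avg F.
Proof.
move=> sF F0 ab a0 bpi Fab.
have mI : measurable (`[a, b]%classic : set (measurableTypeR R)) by exact: measurable_itv.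
have sI : symbol (\1_(`[a, b]%classic) : R -> R).
  apply: (@symbol_by _ 1); first exact: measurable_indic.
  by move=> t; rewrite indicE; case: (_ \in _); rewrite ?normr1 ?normr0.
apply: lt_le_trans (le_avg sI sF _); last first.
  move=> t; rewrite indicE; have [h|h] := pselect (`[a, b]%classic t).
    by rewrite mem_set //; apply: Fab; rewrite /= in_itv in h.
  by rewrite memNset.
rewrite /avg mulr_gt0 ?invr_gt0 ?pi_gt0 // /Rintegral integral_indic //.
have -> : `[a, b]%classic `&` `[0, pi]%classic = `[a, b]%classic :> set R.
  apply/seteqP; split=> t /=; first by case.
  by rewrite !in_itv /= => /andP[h1 h2]; split; apply/andP; split=> //; lra.
have E : @lebesgue_measure R `[a, b]%classic = (b - a)%:E.
  by rewrite lebesgue_measure_itv /= lte_fin ab -EFinD.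
by rewrite [X in fine X]E /= subr_gt0.
Qed.

Definition cdelta (m : int) : seqZ R := fun n => (delta m n)%:C.

Lemma reS_cdelta m : reS (cdelta m) = delta m. Proof. by []. Qed.
Lemma imS_cdelta m : imS (cdelta m) = fun=> 0. Proof. by []. Qed.
Lemma l2_cdelta m : l2 (cdelta m).
Proof. by apply/l2P; split; [exact: l2R_delta|exact: l2R0]. Qed.
Arguments l2_cdelta m : clear implicits.

(** The spectral projections of intervals meeting the spectrum do not vanish:
    the mass that they give to a basis vector is the length of an open set of
    angles, up to the factor pi. *)
Lemma specproj_delta_gt0 x d : -1 <= x <= 1 -> 0 < d ->
  0 < rdot (cdelta 0) (specproj `]x - d, x + d[ (cdelta 0)).
Proof.
move=> x11 d0; set J := `]x - d, x + d[%classic.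
have mJ : measurable (J : set (measurableTypeR R)) by exact: measurable_itv.
rewrite /rdot imS_cdelta [X in _ + X](_ : _ = 0) ?addr0; last first.
  by rewrite /dot; apply: cvg_lim => //; apply: cvg_near_cst; apply: nearW => n;
    rewrite /psumZ big1 // => i _; rewrite mul0r.
rewrite reS_cdelta dot_delta /reS /= reS_cdelta /laurent dotC dot_delta subr0 /coef.
have -> : (fun t => icos J t * cos (0%:~R * t)) = icos J.
  by apply/funext => t; rewrite mul0r cos0 mulr1.
have t0 := acos_ge0 x11; have tpi := acos_lepi x11.
have ct : cos (acos x) = x by rewrite acosK // in_itv.
have /cvgrPdist_lt /(_ _ d0) [e /= e0 eP] := @continuous_cos R (acos x).
pose a := Num.max 0 (acos x - e / 2); pose b := Num.min pi (acos x + e / 2).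
have p0 := pi_gt0 R.
apply: (@avg_gt0 _ a b).
- exact: symbol_icos.
- by move=> t; rewrite /icos indicE.
- by rewrite /a /b lt_min !gt_max; apply/andP; split; apply/andP; split; lra.
- by rewrite /a le_max lexx.
- by rewrite /b ge_min lexx.
- move=> t; rewrite /a /b ge_max le_min => /andP[/andP[_ h1] /andP[_ h2]].
  rewrite /icos indicE mem_set // /J /= in_itv /=.
  have /eP : ball (acos x) e t by rewrite /ball /= ltr_norml; apply/andP; split; lra.
  by rewrite ct ltr_norml => /andP[h3 h4]; apply/andP; split; lra.
Qed.

(** Project a basis vector to the spectral subspace of a small interval about
    [x]. *)
Lemma weyl_vector x d : -1 <= x <= 1 -> 0 < d ->
  exists u, [/\ l2 u, 0 < rdot u u &
    rdot (shiftop x u) (shiftop x u) <= d ^+ 2 * rdot u u].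
Proof.
move=> x11 d0.
have mJ : measurable (`]x - d, x + d[%classic : set (measurableTypeR R)) by exact: measurable_itv.
have lD := l2_cdelta 0; have sJ := symbol_icos mJ.
exists (specproj `]x - d, x + d[ (cdelta 0)); split.
- exact: claurent_l2.
- by rewrite -specproj_mass //; exact: specproj_delta_gt0.
- apply: (spectral_norm_le Delta_bounded Delta_sym (@specproj_Delta R)).
  + exact: ltW.
  + exact: claurent_l2.
  + by rewrite -specprojI // setIid.
Qed.

(** Inside the interval a bounded inverse of [Delta - x] is excluded by
    approximate eigenvectors. *)
Lemma spectrum_Delta : spectrum (@Delta R) = `[-1, 1]%classic.
Proof.
apply/seteqP; split=> x; rewrite /spectrum /= in_itv /=.
  by move=> nr; apply: contrapT => /negP xout; apply: nr; exact: resolvent_out.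
move=> x11 [B [[Bl2 _ [M BM]] BP]].
(* An approximate eigenvector with this error contradicts the bound [M] of
   the inverse. *)
pose d := (`|M| + 1)^-1.
have d0 : 0 < d by rewrite invr_gt0 ltr_wpDl.
have [u [lu u0 Su]] := weyl_vector x11 d0.
have lS : l2 (shiftop x u) by rewrite shiftopE //; apply: claurent_l2 => //; exact: symbol_cosB.
have := BM _ lS; have -> : B (shiftop x u) = u := (BP u lu).1.
rewrite !normsqE // => h.
have S0 := rdot_ge0 lS; have M0 := normr_ge0 M.
have : rdot u u <= `|M| * (d ^+ 2 * rdot u u).
  apply: le_trans h _; apply: le_trans (ler_wpM2r S0 (ler_norm M)) _.
  exact: ler_wpM2l.
rewrite mulrA -[leLHS]mul1r ler_pM2r // => h2.
have : `|M| * d ^+ 2 < 1.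
  have Md : `|M| * d < 1 by rewrite ltr_pdivrMr ?mul1r; lra.
  have d1 : d <= 1 by rewrite invf_le1; lra.
  have Md0 : 0 <= `|M| * d by rewrite mulr_ge0 // ltW.
  rewrite expr2 mulrA; nra.
by rewrite ltNge h2.
Qed.

(** A nondegenerate interval has no isolated points, so the discrete spectrum is
    empty. *)
Lemma ess_spectrum_Delta : ess_spectrum (@Delta R) = `[-1, 1]%classic.
Proof.
rewrite /ess_spectrum spectrum_Delta; apply/seteqP; split=> x; first by case.
move=> x11; split=> // -[+ _ _]; rewrite spectrum_Delta => -[_ [V Vx VE]].
move: x11; rewrite /= in_itv /= => /andP[x1 x2].
have /nbhs_ballP[e /= e0 eV] := Vx.
have H y : -1 <= y <= 1 -> `|x - y| < e -> y = x.
  move=> y11 ye; have : (V `&` `[-1, 1]%classic) y.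
    by split; [exact: eV|rewrite /= in_itv].
  by rewrite VE.
have [x0|x0] := leP x 0.
  pose y := x + Num.min (e / 2) 1.
  have m1 : Num.min (e / 2) 1 <= e / 2 by rewrite ge_min lexx.
  have m2 : Num.min (e / 2) 1 <= 1 by rewrite ge_min lexx orbT.
  have m3 : 0 < Num.min (e / 2) 1 by rewrite lt_min ltr01 andbT divr_gt0.
  have : y = x.
    apply: H; first by rewrite /y; apply/andP; split; lra.
    by rewrite /y ltr_norml; apply/andP; split; lra.
  by rewrite /y; lra.
pose y := x - Num.min (e / 2) 1.
have m1 : Num.min (e / 2) 1 <= e / 2 by rewrite ge_min lexx.
have m2 : Num.min (e / 2) 1 <= 1 by rewrite ge_min lexx orbT.
have m3 : 0 < Num.min (e / 2) 1 by rewrite lt_min ltr01 andbT divr_gt0.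
have : y = x.
  apply: H; first by rewrite /y; apply/andP; split; lra.
  by rewrite /y ltr_norml; apply/andP; split; lra.
by rewrite /y; lra.
Qed.

End Spectrum.
Arguments l2_cdelta {R} m.

(** * The commutator on finitely supported sequences *)

Section Commutator.
Context {R : realType}.
Local Open Scope complex_scope.
Variable kappa : nat.
Implicit Types (u v w : seqZ R) (N : nat) (n m : int).

Local Notation k := (kappa%:Z).
Local Notation A := (@A_formal R kappa).

(** On the Fourier side [A_kappa] is the symmetrized product of [sin (kappa t)]
    and the momentum, and the commutator of the momentum with [cos t]
    contributes the factor [sin t]. *)
Definition comm_symbol (t : R) : R := sin t * sin (kappa%:R * t).

Lemma comm_symbolE t :
  comm_symbol t = 2^-1 * (cos ((k - 1)%:~R * t) - cos ((k + 1)%:~R * t)).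
Proof.
have -> : (k - 1)%:~R * t = kappa%:R * t - t :> R by rewrite intrB mulrBl mul1r.
have -> : (k + 1)%:~R * t = kappa%:R * t + t :> R by rewrite intrD mulrDl mul1r.
by rewrite cosB cosD /comm_symbol; field.
Qed.

Lemma symbol_comm : symbol comm_symbol.
Proof.
rewrite (funext comm_symbolE).
by apply: symbolZ; apply: symbolB; exact: symbol_cosM.
Qed.

Definition comm_diff u : seqZ R := fun n =>
  4%:R^-1 * (u (n - k + 1) + u (n + k - 1) - u (n - k - 1) - u (n + k + 1)).

Lemma comm_laurent u : l2 u -> claurent comm_symbol u = comm_diff u.
Proof.
move=> lu; apply/funext => n.
rewrite (funext comm_symbolE) claurent_symZ //; last by apply: symbolB; exact: symbol_cosM.
rewrite claurent_symB //; try exact: symbol_cosM.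
rewrite !claurent_cosM // /comm_diff.
have -> : n - (k - 1) = n - k + 1 by lia.
have -> : n + (k - 1) = n + k - 1 by lia.
have -> : n - (k + 1) = n - k - 1 by lia.
have -> : n + (k + 1) = n + k + 1 by lia.
have -> : (2^-1 : R)%:C = 2%:R^-1 :> R[i] by rewrite fmorphV /= rmorph_nat.
by field.
Qed.

Let c : R[i] := (4%:R * 'i%C)^-1.

Let ic : 'i%C * c = 4%:R^-1.
Proof.
rewrite /c invfM mulrCA mulfV ?mulr1 //.
by apply/eqP => /(congr1 (@complex.Im R)) /= /eqP; rewrite oner_eq0.
Qed.

Let conj_c : (c^*)%C = - c.
Proof.
have i0 : 'i%C != 0 :> R[i].
  by apply/eqP => /(congr1 (@complex.Im R)) /= /eqP; rewrite oner_eq0.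
have ii : 'i%C * 'i%C = -1 :> R[i] by rewrite -expr2 sqr_i.
have -> : c = - ('i%C / 4%:R).
  rewrite /c; apply: (mulfI (x := 4%:R * 'i%C)); first by rewrite mulf_neq0 // pnatr_eq0.
  rewrite mulfV ?mulf_neq0 ?pnatr_eq0 //.
  have -> : 4%:R * 'i%C * - ('i%C / 4%:R) = - ('i%C * 'i%C) :> R[i] by field.
  by rewrite ii opprK.
have -> : 'i%C / 4%:R = (0 : R) +i* (4%:R^-1).
  have -> : 4%:R^-1 = (4%:R^-1 : R)%:C :> R[i] by rewrite fmorphV /= rmorph_nat.
  by simpc.
by simpc.
Qed.

Let AE u n : A u n =
  c * ((n + n - k)%:~R * u (n - k) - (n + n + k)%:~R * u (n + k)).
Proof.
rewrite /A_formal /dshift /position /shiftZ opprK -/c; congr (_ * _).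
by rewrite !intrB !intrD; ring.
Qed.

(** The terms that grow linearly in [n] cancel. This holds for all sequences,
    because both operators are finite difference operators. *)
Lemma comm_formal u n : 'i%C * (Delta (A u) n - A (Delta u) n) = comm_diff u n.
Proof.
rewrite /Delta /shiftZ !AE !opprK /comm_diff -ic.
have -> : n - 1 - k = n - k - 1 by lia.
have -> : n + 1 - k = n - k + 1 by lia.
have -> : n - 1 + k = n + k - 1 by lia.
have -> : n + 1 + k = n + k + 1 by lia.
by rewrite !(intrB, intrD); field.
Qed.

Lemma finsupp_in u : finsupp u -> exists N, supp_in N u.
Proof.
move=> /finite_seqP[s us]; exists (\max_(x <- s) `|x|%N) => n nN.
apply: contrapT => un; have ns : n \in s by have : [set` s] n by rewrite -us.
have := @leq_bigmax_seq _ s (fun=> true) (fun x => `|x|%N) n ns isT.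
by rewrite leqNgt nN.
Qed.

Lemma inner_fin N u v : supp_in N u -> inner u v = wsum (fun n => (u n)^*%C * v n) N.
Proof.
move=> u0.
have re0 n : (N < `|n|)%N -> complex.Re ((u n)^*%C * v n) = 0.
  by move=> /u0 ->; case: (v n) => x y /=; rewrite oppr0 !mul0r subr0.
have im0 n : (N < `|n|)%N -> complex.Im ((u n)^*%C * v n) = 0.
  by move=> /u0 ->; case: (v n) => x y /=; rewrite oppr0 !mul0r addr0.
rewrite /inner /sumZ (cvg_lim _ (sumZ_out re0)) // (cvg_lim _ (sumZ_out im0)) //.
apply/eqP; rewrite eq_complex /=; apply/andP; split; apply/eqP; rewrite /psumZ /wsum.
  by rewrite (big_morph (@complex.Re R) (id1 := 0) (op1 := +%R)) // => -[x y] [x' y'].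
by rewrite (big_morph (@complex.Im R) (id1 := 0) (op1 := +%R)) // => -[x y] [x' y'].
Qed.

Lemma supp_in_l2 N u : supp_in N u -> l2 u.
Proof. by move=> u0; apply/l2P; split; apply: (@l2R_fin _ _ N) => n /u0; rewrite /reS /imS => ->. Qed.

Lemma supp_in_A N u : supp_in N u -> supp_in (N + kappa) (A u).
Proof.
move=> u0 n nN; rewrite AE !u0 ?mulr0 ?subr0 ?mulr0 //; lia.
Qed.

(** Summation by parts, with a window large enough that shifting by [kappa]
    loses no term. *)
Lemma A_sym N u v : supp_in N u -> inner (A u) v = inner u (A v).
Proof.
move=> u0.
have [a [aE aJ]] : exists a : R[i], (forall w n, A w n =
    a * ((n + n - k)%:~R * w (n - k) - (n + n + k)%:~R * w (n + k))) /\ (a^*)%C = - a.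
  by exists c; split; [exact: AE|exact: conj_c].
pose f1 n := (n + n + k)%:~R * ((u n)^*%C * v (n + k)) : R[i].
pose f2 n := (n + n + k)%:~R * ((u (n + k))^*%C * v n) : R[i].
have s1 : supp_in N f1.
  by move=> n /u0 un; rewrite /f1 un conjc0 mul0r mulr0.
have s2 : supp_in (N + kappa) f2.
  by move=> n nN; rewrite /f2 (supp_in_shift u0 nN) conjc0 mul0r mulr0.
(* Moving the support of [f2] twice by [kappa] must not leave the window. *)
pose K := (N + kappa + kappa + kappa)%N.
have uK : supp_in K u by move=> n nK; apply: u0; rewrite /K in nK; lia.
have AuK : supp_in K (A u) by move=> n nK; apply: (supp_in_A u0); rewrite /K in nK; lia.
rewrite (inner_fin v AuK) (inner_fin (A v) uK).
transitivity (wsum (fun n => a * f2 n) K - wsum (fun n => a * f1 (n - k)) K).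
  rewrite /wsum -sumrB; apply: eq_bigr => i _; move: (i%:Z - K%:Z) => n.
  rewrite aE /f1 /f2 rmorphM /= rmorphB /= !rmorphM /= aJ !rmorph_int subrK.
  have -> : n - k + (n - k) + k = n + n - k by lia.
  ring.
have wZ (f : int -> R[i]) : wsum (fun n => a * f n) K = a * wsum f K by rewrite /wsum mulr_sumr.
transitivity (wsum (fun n => a * f2 (n - k)) K - wsum (fun n => a * f1 n) K); last first.
  rewrite /wsum -sumrB; apply: eq_bigr => i _; move: (i%:Z - K%:Z) => n.
  rewrite aE /f1 /f2 subrK.
  have -> : n - k + (n - k) + k = n + n - k by lia.
  by ring.
rewrite !wZ.
by rewrite (wsum_shiftN s1) ?(wsum_shiftN s2) // /K; lia.
Qed.

End Commutator.

(** * The bounded extension of the commutator *)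

Section CommutatorExtension.
Context {R : realType}.
Local Open Scope complex_scope.
Variable kappa : nat.
Implicit Types (u v w : seqZ R) (N : nat) (n m : int).

Local Notation A := (@A_formal R kappa).
Local Notation C := (claurent (@comm_symbol R kappa)).

Let sC : symbol (@comm_symbol R kappa) := symbol_comm kappa.

Lemma comm_finite N K u v : supp_in N u -> supp_in K v ->
  inner u (C v) = 'i%C * (inner (Delta u) (A v) - inner (A u) (Delta v)).
Proof.
move=> u0 v0; have lu := supp_in_l2 u0; have lv := supp_in_l2 v0.
have lAv : l2 (A v) := supp_in_l2 (supp_in_A v0).
rewrite (A_sym kappa _ u0).
have -> : inner (Delta u) (A v) = inner u (Delta (A v)).
  by rewrite !Delta_laurent // claurent_sym //; exact: symbol_cos.
rewrite comm_laurent // -(funext (comm_formal kappa v)) !(inner_fin _ u0) /wsum.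
rewrite -sumrB mulr_sumr; apply: eq_bigr => i _; ring.
Qed.

Lemma normsq_cvg0 (x : nat -> seqZ R) : (forall i, l2 (x i)) ->
  (fun i => normsq (x i)) @ \oo --> (0 : R) ->
  (fun i => dot (reS (x i)) (reS (x i))) @ \oo --> (0 : R) /\
  (fun i => dot (imS (x i)) (imS (x i))) @ \oo --> (0 : R).
Proof.
move=> lx x0.
have h i : 0 <= dot (reS (x i)) (reS (x i)) /\ 0 <= dot (imS (x i)) (imS (x i)).
  by split; apply: dot_ge0; [exact: l2_re|exact: l2_im].
split; apply: (squeeze_cvgr _ (cvg_cst 0) x0); apply: nearW => i;
  have [h1 h2] := h i; rewrite normsqE // /rdot; apply/andP; split=> //; lra.
Qed.

Lemma inner_cvg (x y : nat -> seqZ R) u v :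
  (forall i, l2 (x i)) -> (forall i, l2 (y i)) -> l2 u -> l2 v ->
  (fun i => normsq (fun n => x i n - u n)) @ \oo --> (0 : R) ->
  (fun i => normsq (fun n => y i n - v n)) @ \oo --> (0 : R) ->
  (fun i => complex.Re (inner (x i) (y i))) @ \oo --> complex.Re (inner u v) /\
  (fun i => complex.Im (inner (x i) (y i))) @ \oo --> complex.Im (inner u v).
Proof.
move=> lx ly lu lv xu yv.
have [xr xi] := normsq_cvg0 (fun i => l2B (lx i) lu) xu.
have [yr yi] := normsq_cvg0 (fun i => l2B (ly i) lv) yv.
have xr' : (fun i => dot (fun n => reS (x i) n - reS u n) (fun n => reS (x i) n - reS u n)) @ \oo --> (0 : R).
  by move: xr; under eq_fun do rewrite reSB.
have xi' : (fun i => dot (fun n => imS (x i) n - imS u n) (fun n => imS (x i) n - imS u n)) @ \oo --> (0 : R).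
  by move: xi; under eq_fun do rewrite imSB.
have yr' : (fun i => dot (fun n => reS (y i) n - reS v n) (fun n => reS (y i) n - reS v n)) @ \oo --> (0 : R).
  by move: yr; under eq_fun do rewrite reSB.
have yi' : (fun i => dot (fun n => imS (y i) n - imS v n) (fun n => imS (y i) n - imS v n)) @ \oo --> (0 : R).
  by move: yi; under eq_fun do rewrite imSB.
have lxr i := l2_re (lx i); have lxi i := l2_im (lx i).
have lyr i := l2_re (ly i); have lyi i := l2_im (ly i).
have [lur lui] := (l2P u).1 lu; have [lvr lvi] := (l2P v).1 lv.
have ReE (a b : seqZ R) : l2 a -> l2 b ->
    complex.Re (inner a b) = dot (reS a) (reS b) + dot (imS a) (imS b) by move=> la lb; rewrite innerE.
have ImE (a b : seqZ R) : l2 a -> l2 b ->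
    complex.Im (inner a b) = dot (reS a) (imS b) - dot (imS a) (reS b) by move=> la lb; rewrite innerE.
split.
  rewrite (ReE _ _ lu lv) (funext (fun i => ReE _ _ (lx i) (ly i))).
  by apply: cvgD; [exact: dot_cvg xr' yr'|exact: dot_cvg xi' yi'].
rewrite (ImE _ _ lu lv) (funext (fun i => ImE _ _ (lx i) (ly i))).
by apply: cvgB; [exact: dot_cvg xr' yi'|exact: dot_cvg xi' yr'].
Qed.

Lemma op_cvg (T : oper R) (x : nat -> seqZ R) u : bounded_op T ->
  (forall i, l2 (x i)) -> l2 u ->
  (fun i => normsq (fun n => x i n - u n)) @ \oo --> (0 : R) ->
  (fun i => normsq (fun n => T (x i) n - T u n)) @ \oo --> (0 : R).
Proof.
move=> bT lx lu xu; have [_ _ [M BM]] := bT.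
have C0 : (fun i => M * normsq (fun n => x i n - u n)) @ \oo --> (0 : R).
  by rewrite -(mulr0 M); apply: cvgMr.
apply: (squeeze_cvgr _ (cvg_cst 0) C0); apply: nearW => i.
have ld := l2B (lx i) lu.
rewrite -(opB bT (lx i) lu) BM // andbT normsqE; last exact: op_l2.
by apply: rdot_ge0; exact: op_l2.
Qed.

(** The identity passes from finitely supported sequences to the closure because
    every term of it is continuous for the graph norm. *)
Lemma comm_extension : commutator_extension (@Delta R) (@A_kappa R kappa) C.
Proof.
have bC := claurent_bounded sC.
split=> // u Au v Av [lu lAu [us [fu uu Auu]]] [lv lAv [vs [fv vv Avv]]].
have lus i : l2 (us i) by have [N /supp_in_l2] := finsupp_in (fu i).
have lvs i : l2 (vs i) by have [N /supp_in_l2] := finsupp_in (fv i).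
have lAus i : l2 (A (us i)) by have [N u0] := finsupp_in (fu i); exact: supp_in_l2 (supp_in_A u0).
have lAvs i : l2 (A (vs i)) by have [N u0] := finsupp_in (fv i); exact: supp_in_l2 (supp_in_A u0).
have bD := Delta_bounded (R := R).
have lCv i := op_l2 bC (lvs i); have lDu i := op_l2 bD (lus i); have lDv i := op_l2 bD (lvs i).
have Cvv := op_cvg bC lvs lv vv.
have Duu := op_cvg bD lus lu uu; have Dvv := op_cvg bD lvs lv vv.
have [X1 X2] := inner_cvg lus lCv lu (op_l2 bC lv) uu Cvv.
have [Y1 Y2] := inner_cvg lDu lAvs (op_l2 bD lu) lAv Duu Avv.
have [Z1 Z2] := inner_cvg lAus lDv lAu (op_l2 bD lv) Auu Dvv.
have E i : inner (us i) (C (vs i)) = 'i%C * (inner (Delta (us i)) (A (vs i)) - inner (A (us i)) (Delta (vs i))).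
  have [N u0] := finsupp_in (fu i); have [K v0] := finsupp_in (fv i).
  exact: comm_finite u0 v0.
have Re_i (y z : R[i]) : complex.Re ('i%C * (y - z)) = complex.Im z - complex.Im y.
  by case: y z => [a b] [a' b'] /=; ring.
have Im_i (y z : R[i]) : complex.Im ('i%C * (y - z)) = complex.Re y - complex.Re z.
  by case: y z => [a b] [a' b'] /=; ring.
have E1 i := etrans (congr1 (@complex.Re R) (E i)) (Re_i _ _).
have E2 i := etrans (congr1 (@complex.Im R) (E i)) (Im_i _ _).
rewrite (funext E1) in X1; rewrite (funext E2) in X2.
apply/eqP; rewrite eq_complex; apply/andP; split; apply/eqP.
  by rewrite Re_i; apply: (cvg_unique _ X1) => //; exact: cvgB Z2 Y2.
by rewrite Im_i; apply: (cvg_unique _ X2) => //; exact: cvgB Y1 Z1.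
Qed.

Lemma A_kappa_fin N u : supp_in N u -> A_kappa kappa u (A u).
Proof.
move=> u0; split; [exact: supp_in_l2 u0|exact: supp_in_l2 (supp_in_A u0)|].
have z (w : seqZ R) : normsq (fun n => w n - w n) = 0.
  have -> : (fun n => w n - w n) = fun=> 0 by apply/funext => n; rewrite subrr.
  by rewrite normsqE ?rdot0l //; exact: l2_0.
exists (fun=> u); split.
- move=> _; apply: (sub_finite_set (B := [set` [seq k%:Z - N%:Z | k <- iota 0 N.*2.+1]])).
    move=> n un; rewrite /mkset; apply/mapP; exists (absz (n + N%:Z)); last first.
      have : (`|n| <= N)%N by rewrite leqNgt; apply/negP => /u0.
      lia.
    rewrite mem_iota; have : (`|n| <= N)%N by rewrite leqNgt; apply/negP => /u0.
    lia.
  exact: finite_seq.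
- by rewrite z; exact: cvg_cst.
- by rewrite z; exact: cvg_cst.
Qed.

Definition ctrunc N u : seqZ R := fun n => if (`|n| <= N)%N then u n else 0.

Lemma supp_in_ctrunc N u : supp_in N (ctrunc N u).
Proof. by move=> n nN; rewrite /ctrunc leqNgt nN. Qed.

Lemma ctrunc_cvg u : l2 u -> (fun N => normsq (fun n => ctrunc N u n - u n)) @ \oo --> (0 : R).
Proof.
move=> lu; have [lr li] := (l2P u).1 lu.
have E N : normsq (fun n => ctrunc N u n - u n) =
    dot (fun n => trunc N (reS u) n - reS u n) (fun n => trunc N (reS u) n - reS u n) +
    dot (fun n => trunc N (imS u) n - imS u n) (fun n => trunc N (imS u) n - imS u n).
  rewrite normsqE; last by apply: l2B => //; exact: supp_in_l2 (supp_in_ctrunc (N := N) u).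
  rewrite /rdot reSB imSB.
  have -> : reS (ctrunc N u) = trunc N (reS u) by apply/funext => n; rewrite /reS /ctrunc /trunc; case: ifP.
  have -> // : imS (ctrunc N u) = trunc N (imS u) by apply/funext => n; rewrite /imS /ctrunc /trunc; case: ifP.
rewrite (funext E) -[X in _ --> X]addr0.
by apply: cvgD; exact: trunc_cvg.
Qed.

Lemma inner_cdelta m w : inner (cdelta m) w = w m.
Proof.
rewrite [RHS](_ : _ = dot (delta m) (reS w) +i* dot (delta m) (imS w)); last first.
  by rewrite !dot_delta /reS /imS; case: (w m).
rewrite /inner /dot; congr (_ +i* _); congr sumZ; apply/funext => n; rewrite /reS /imS /cdelta.
  by case: (w n) => x y /=; ring.
by case: (w n) => x y /=; ring.
Qed.

(** A bounded extension is determined by its matrix coefficients against the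
    standard basis and by continuity. *)
Lemma commutatorE v : l2 v -> commutator (@Delta R) (A_kappa kappa) v = C v.
Proof.
move=> lv.
have bC := claurent_bounded sC.
have [bD DE] : commutator_extension (@Delta R) (A_kappa kappa) (commutator (@Delta R) (A_kappa kappa)).
  rewrite /commutator.
  have := @xgetPex _ (fun _ _ => 0 : R[i]) [set C : seqZ R -> seqZ R |
    commutator_extension (@Delta R) (A_kappa kappa) C].
  by apply; exists C; exact: comm_extension.
set D := commutator _ _ in bD DE *.
have fin N w : supp_in N w -> D w = C w.
  move=> w0; apply/funext => m; rewrite -(inner_cdelta m (D w)) -(inner_cdelta m (C w)).
  have d0 : supp_in `|m|%N (cdelta m : seqZ R) by move=> n nm; rewrite /cdelta delta_out.
  by rewrite (DE _ _ _ _ (A_kappa_fin d0) (A_kappa_fin w0)) (comm_finite d0 w0).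
have lt N : l2 (ctrunc N v) := supp_in_l2 (supp_in_ctrunc (N := N) v).
have H1 := op_cvg bD lt lv (ctrunc_cvg lv).
have H2 := op_cvg bC lt lv (ctrunc_cvg lv).
have E N : D (ctrunc N v) = C (ctrunc N v) := fin N _ (supp_in_ctrunc (N := N) v).
apply/funext => m; rewrite -(inner_cdelta m (D v)) -(inner_cdelta m (C v)).
have cst0 : (fun _ : nat => normsq (fun n => cdelta m n - cdelta m n : R[i])) @ \oo --> (0 : R).
  have -> : (fun n => cdelta m n - cdelta m n : R[i]) = fun=> 0 by apply/funext => n; rewrite subrr.
  by rewrite normsqE ?rdot0l //; [exact: cvg_cst|exact: l2_0|exact: l2_0].
have ld := l2_cdelta (R := R) m.
have [X1 X2] := inner_cvg (fun _ => ld) (fun N => op_l2 bD (lt N)) ld (op_l2 bD lv) cst0 H1.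
have [Y1 Y2] := inner_cvg (fun _ => ld) (fun N => op_l2 bC (lt N)) ld (op_l2 bC lv) cst0 H2.
apply/eqP; rewrite eq_complex; apply/andP; split; apply/eqP.
  by apply: (cvg_unique _ X1) => //; rewrite (funext (fun N => congr1 (fun w => complex.Re (inner (cdelta m) w)) (E N))).
by apply: (cvg_unique _ X2) => //; rewrite (funext (fun N => congr1 (fun w => complex.Im (inner (cdelta m) w)) (E N))).
Qed.

End CommutatorExtension.

(** * Thresholds *)

Section Thresholds.
Context {R : realType}.
Local Open Scope complex_scope.
Variable kappa : nat.
Hypothesis kappa_gt0 : (0 < kappa)%N.
Implicit Types (u v w : seqZ R) (x t d : R).

Local Notation g := (@comm_symbol R kappa).
Local Notation C := (claurent g).
Local Notation P := (spectral_projection (@Delta R)).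
Local Notation threshold_set := [set x : R | exists2 j : nat, (j <= kappa %/ 2)%N &
  x = cos (pi * j%:R / kappa%:R) \/ x = - cos (pi * j%:R / kappa%:R)].

Let hP : spectral_measure_of (@Delta R) P := @spectral_projection_Delta R.

(** The polynomial is [(1 - x ^ 2) U_(kappa - 1)] with the Chebyshev polynomial
    of the second kind, and the recursion is that of the [U_n]. Being a
    polynomial in the cosine is what makes the commutator a polynomial in the
    Laplacian. *)
Lemma comm_poly : exists p : {poly R}, forall t, g t = p.[cos t].
Proof.
suff H k : (exists p : {poly R}, forall t, sin t * sin (k%:R * t) = p.[cos t]) /\
    (exists p : {poly R}, forall t, sin t * sin (k.+1%:R * t) = p.[cos t]).
  by have [[p pE] _] := H kappa; exists p.
elim: k => [|k [[p pE] [q qE]]].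
  split; first by exists 0 => t; rewrite mul0r sin0 mulr0 horner0.
  by exists (1 - 'X ^+ 2) => t; rewrite mul1r !hornerE -expr2 sin2cos2.
split; first by exists q.
exists ('X *+ 2 * q - p) => t.
rewrite !hornerE -pE -qE.
have -> : k.+2%:R * t = k.+1%:R * t + t :> R by rewrite -[in LHS]addn1 natrD mulrDl mul1r.
have -> : k%:R * t = k.+1%:R * t - t :> R by rewrite -[in RHS]addn1 natrD mulrDl mul1r addrK.
by rewrite sinD sinB; ring.
Qed.

Lemma sin0_natpi y : 0 <= y -> sin y = 0 -> exists m : nat, y = m%:R * pi :> R.
Proof.
move=> y0 sy; have p0 := pi_gt0 R.
pose m := Num.truncn (y / pi).
have /andP[h1 h2] := truncn_itv (divr_ge0 y0 (ltW p0)).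
exists m.
have r0 : 0 <= y - m%:R * pi by rewrite subr_ge0 -ler_pdivlMr.
have r1 : y - m%:R * pi < pi.
  by rewrite ltrBlDr -[X in X + _]mul1r -mulrDl -ltr_pdivrMr // addrC natr1.
have sr : sin (y - m%:R * pi) = 0 by rewrite sinB sy sin_natpi mulr0 mul0r subrr.
apply/eqP; rewrite -subr_eq0 eq_le r0 andbT leNgt; apply/negP => rp.
by have := @sin_gt0_pi R _ (introT andP (conj rp r1)); rewrite sr ltxx.
Qed.

Let k0 : 0 < kappa%:R :> R. Proof. by rewrite ltr0n. Qed.

Let kmul (m : nat) : kappa%:R * (pi * m%:R / kappa%:R) = m%:R * pi :> R.
Proof. by field; rewrite gt_eqF. Qed.

Definition grid (m : nat) : R := cos (pi * m%:R / kappa%:R).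

Lemma grid_opp (m : nat) : (m <= kappa)%N -> grid m = - grid (kappa - m).
Proof.
move=> mk; rewrite /grid natrB //.
have -> : pi * (kappa%:R - m%:R) / kappa%:R = pi - pi * m%:R / kappa%:R :> R by field; rewrite gt_eqF.
by rewrite cosB cospi sinpi mul0r addr0 mulN1r opprK.
Qed.

(** The points with a minus sign are the grid points beyond the middle, by the
    symmetry of the cosine about pi / 2. *)
Lemma threshold_grid : threshold_set = grid @` `I_kappa.+1.
Proof.
apply/seteqP; split=> x.
  move=> [j jk]; have jk' : (j <= kappa)%N by apply: leq_trans jk (leq_div _ _).
  move=> [->|->]; first by exists j.
  exists (kappa - j)%N; first by rewrite /= ltnS leq_subr.
  by rewrite grid_opp ?leq_subr // subKn.
move=> [m /=]; rewrite ltnS => mk <-.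
have [h|h] := leqP m (kappa %/ 2); first by exists m => //; left.
exists (kappa - m)%N; first by lia.
by right; rewrite grid_opp.
Qed.

Lemma grid_inj : {in `I_kappa.+1 &, injective grid}.
Proof.
move=> i j; rewrite !inE /= !ltnS => ik jk /cos_inj.
have p0 := pi_gt0 R.
have I01 (m : nat) : (m <= kappa)%N -> pi * m%:R / kappa%:R \in `[0, pi : R].
  move=> mk; rewrite in_itv /= !mulr_ge0 ?invr_ge0 ?(ltW p0) //=.
  by rewrite ler_pdivrMr // ler_wpM2l ?(ltW p0) // ler_nat.
move=> /(_ (I01 i ik) (I01 j jk)) E.
have := congr1 (fun y => kappa%:R * y) E; rewrite !kmul => /(mulIf (lt0r_neq0 p0)) /eqP.
by rewrite eqr_nat => /eqP.
Qed.

(** The product vanishes when [t] is a multiple of pi or of [pi / kappa]; the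
    first possibility is contained in the second. *)
Lemma comm_zero t : 0 <= t -> t <= pi -> (g t = 0 <-> threshold_set (cos t)).
Proof.
move=> t0 tpi; have p0 := pi_gt0 R; have [p pE] := comm_poly.
rewrite threshold_grid; split.
  move/eqP; rewrite mulf_eq0 => /orP[/eqP st|/eqP st].
    have [m tm] := sin0_natpi t0 st.
    have mk : (m <= 1)%N.
      by rewrite -(ler_nat R) -(ler_pM2r p0) mul1r; apply: le_trans tpi; rewrite tm.
    exists (m * kappa)%N; first by rewrite /= ltnS -[X in (_ <= X)%N]mul1n leq_mul2r mk orbT.
    by rewrite /grid tm natrM; congr cos; field; rewrite gt_eqF.
  have [m tm] := sin0_natpi (mulr_ge0 (ltW k0) t0) st.
  have mk : (m <= kappa)%N.
    rewrite -(ler_nat R) -(ler_pM2r p0); apply: le_trans (_ : kappa%:R * t <= _); first by rewrite tm.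
    by rewrite ler_wpM2l // ltW.
  exists m; first by rewrite /= ltnS.
  rewrite /grid; congr cos; apply: (mulfI (lt0r_neq0 k0)); rewrite tm; exact: kmul.
move=> [m _ mt]; rewrite pE -mt -pE /comm_symbol kmul sin_natpi mulr0.
by [].
Qed.

(** By the factor theorem [p - p.[x]] is a multiple of [X - x], so on the range
    of the projection the commutator differs from the constant [p.[x]] by a
    bounded operator composed with [Delta - x], which is small there. *)
Lemma form_near (p : {poly R}) x : (forall t, g t = p.[cos t]) ->
  exists2 K : R, 0 <= K & forall d w, 0 <= d -> l2 w -> P `]x - d, x + d[ w = w ->
    `|rdot w (C w) - p.[x] * rdot w w| <= K * d * rdot w w.
Proof.
move=> pE.
have [q qE] : exists q, p - p.[x]%:P = q * ('X - x%:P).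
  by apply/factor_theorem; rewrite /root !hornerE subrr.
have mQ := mult_polycos q; have [sQ _] := mQ; have [_ [K bK]] := sQ.
have K0 := bounded_by_ge0 bK.
exists K => // d w d0 lw Pw.
have lS : l2 (shiftop x w) by rewrite shiftopE //; apply: claurent_l2 => //; exact: symbol_cosB.
have Sw := spectral_norm_le Delta_bounded Delta_sym hP d0 lw Pw.
rewrite -/(shiftop x w) in Sw.
have sg : symbol g := symbol_comm kappa.
have lC := claurent_l2 sg lw.
have -> : rdot w (C w) - p.[x] * rdot w w = rdot w (claurent (fun t => q.[cos t]) (shiftop x w)).
  rewrite -(rdotZr _ lw lw) -(rdotBr lw lC (l2Z _ lw)); congr (rdot w _).
  rewrite shiftopE // -(claurentM mQ (symbol_cosB x) lw).
  have -> : (fun n => C w n - (p.[x])%:C * w n) = claurent (fun t => g t - p.[x]) w.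
    by rewrite (claurent_symB sg (symbol_cst _) lw) (claurent_cst _ lw).
  congr (claurent _ w); apply/funext => t.
  by have := congr1 (fun r => r.[cos t]) qE; rewrite !hornerE -pE.
have lQ := claurent_l2 sQ lS; have w0 := rdot_ge0 lw; have S0 := rdot_ge0 lS.
rewrite -(ler_pXn2r (n := 2)) ?nnegrE ?mulr_ge0 //.
rewrite -normrX ger0_norm ?sqr_ge0 //; apply: le_trans (rdot_CS lw lQ) _.
have -> : (K * d * rdot w w) ^+ 2 = rdot w w * (K ^+ 2 * (d ^+ 2 * rdot w w)) by ring.
apply: ler_wpM2l => //; apply: le_trans (claurent_rdot_le sQ bK lS) _.
by apply: ler_wpM2l => //; exact: sqr_ge0.
Qed.

(** The projection and the commutator are self-adjoint, so both sides of the
    Mourre inequality at [u] are real numbers that depend only on [P I u]. *)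
Lemma mu_form (I : set (measurableTypeR R)) (e gamma : R) u : measurable I -> l2 u ->
  (gamma%:C * inner u (P I u) <= e%:C * inner u (P I (commutator (@Delta R) (A_kappa kappa) (P I u)))) =
  (gamma * rdot (P I u) (P I u) <= e * rdot (P I u) (C (P I u))).
Proof.
move=> mI lu; have [oP _ _ _] := hP; have [bP PP symP] := oP I mI.
have lw := op_l2 bP lu; have sg : symbol g := symbol_comm kappa.
rewrite commutatorE //.
have -> : inner u (P I u) = (rdot (P I u) (P I u))%:C.
  by rewrite -inner_self // symP // PP.
rewrite -symP //; last exact: claurent_l2.
by rewrite claurent_inner_real // -!rmorphM /= lecR.
Qed.

(** Near a point where the symbol does not vanish it keeps its sign, and half
    its absolute value is an admissible constant. *)
Lemma mu_in x : -1 <= x <= 1 -> ~ threshold_set x -> mu_set (@Delta R) (A_kappa kappa) x.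
Proof.
move=> x11 nx; have [p pE] := comm_poly.
have ct : cos (acos x) = x by rewrite acosK // in_itv.
have px : p.[x] != 0.
  apply/eqP => px; apply: nx; rewrite -ct.
  apply/(comm_zero (acos_ge0 x11) (acos_lepi x11)).
  by rewrite pE ct.
have [K K0 HK] := form_near x pE.
pose c := `|p.[x]|; have c0 : 0 < c by rewrite normr_gt0.
(* Small enough that the error [K * d] of the form is at most [c / 2]; adding
   1 allows [K = 0]. *)
pose d := c / (2 * (K + 1)).
have d0 : 0 < d by rewrite divr_gt0 // mulr_gt0 // ltr_wpDl.
have Kd : K * d <= c / 2.
  rewrite /d mulrA ler_pdivrMr ?mulr_gt0 ?ltr_wpDl //.
  have -> : c / 2 * (2 * (K + 1)) = K * c + c by field.
  by rewrite lerDl ltW.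
have sx : spectrum (@Delta R) x by rewrite spectrum_Delta /= in_itv.
have mI : measurable (`]x - d, x + d[%classic : set (measurableTypeR R)) by exact: measurable_itv.
have bound (e : R) u : e * p.[x] = c -> `|e| = 1 -> l2 u ->
    (c / 2)%:C * inner u (P `]x - d, x + d[ u) <=
    e%:C * inner u (P `]x - d, x + d[ (commutator (@Delta R) (A_kappa kappa) (P `]x - d, x + d[ u))).
  move=> ep e1 lu; rewrite mu_form //.
  have [oP _ _ _] := hP; have [bP PP _] := oP _ mI.
  have lw := op_l2 bP lu.
  set w := P _ u in lw *; have w0 := rdot_ge0 lw.
  have h : `|e * rdot w (C w) - c * rdot w w| <= K * d * rdot w w.
    by rewrite -ep -[e * _ * _]mulrA -mulrBr normrM e1 mul1r; exact: HK d w (ltW d0) lw (PP u lu).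
  have h2 := ler_wpM2r w0 Kd.
  have h3 := ler_norm (- (e * rdot w (C w) - c * rdot w w)); rewrite normrN in h3.
  by move: (e * rdot w (C w)) (K * d * rdot w w) h h2 h3 => X Y h h2 h3; lra.
have [pp|pn] := ltP 0 p.[x]; [left|right]; (split=> //; exists `]x - d, x + d[%classic, (c / 2); split).
- exact: interval_open.
- exact: interval_is_interval.
- by rewrite /= in_itv /=; apply/andP; split; lra.
- by rewrite divr_gt0.
- by move=> Q u lu; apply: (bound 1) => //; [rewrite mul1r /c gtr0_norm|rewrite normr1].
- exact: interval_open.
- exact: interval_is_interval.
- by rewrite /= in_itv /=; apply/andP; split; lra.
- by rewrite divr_gt0.
- move=> Q u lu; have -> : (- 1 : R[i]) = (-1 : R)%:C by rewrite rmorphN1.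
  by apply: bound => //; [rewrite mulN1r /c ler0_norm|rewrite normrN1].
Qed.

(** At a zero of the symbol the form of the commutator on small spectral
    subspaces is smaller than any prescribed constant, and these subspaces are
    nonzero because the point lies in the spectrum. *)
Lemma mu_out x (e : R) : -1 <= x <= 1 -> threshold_set x -> `|e| = 1 ->
  ~ mu_sgn e%:C (@Delta R) (A_kappa kappa) x.
Proof.
move=> x11 Tx e1 [_ [I [gamma [oI _ Ix gamma0 H]]]]; have [p pE] := comm_poly.
have ct : cos (acos x) = x by rewrite acosK // in_itv.
have px : p.[x] = 0.
  rewrite -ct -pE; apply/(comm_zero (acos_ge0 x11) (acos_lepi x11)).
  by rewrite ct.
have [K K0 HK] := form_near x pE.
have /nbhs_ballP[r /= r0 rI] := open_nbhs_nbhs (conj oI Ix).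
pose d := Num.min r (gamma / (2 * (K + 1))).
have d0 : 0 < d by rewrite lt_min r0 divr_gt0 // mulr_gt0 // ltr_wpDl.
have Kd : K * d < gamma.
  have h : d <= gamma / (2 * (K + 1)) by rewrite ge_min lexx orbT.
  rewrite ler_pdivlMr in h; last by rewrite mulr_gt0 // ltr_wpDl.
  nra.
pose J : set (measurableTypeR R) := `]x - d, x + d[%classic.
have mJ : measurable J by exact: measurable_itv.
have mI : measurable (I : set (measurableTypeR R)) by exact: open_measurable.
have JI : J `<=` I.
  move=> y; rewrite /J /= in_itv /= => /andP[h1 h2]; apply: rI.
  have h : d <= r by rewrite ge_min lexx.
  by rewrite /ball /= ltr_norml; apply/andP; split; lra.
have d2 : 0 < d / 2 by rewrite divr_gt0.
have [u [lu u0 Su]] := weyl_vector x11 d2.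
have Su' : rdot (shiftop x u) (shiftop x u) < d ^+ 2 * rdot u u.
  apply: le_lt_trans Su _; rewrite ltr_pM2r // exprMn.
  have := exprn_gt0 2 d0; lra.
have [w [lw Pw w0]] := spectral_nonzero Delta_bounded Delta_sym hP d0 lu Su'.
have [oP _ PI _] := hP.
have PIw : P I w = w.
  rewrite -{1}Pw -PI //; have -> : I `&` J = J by apply/seteqP; split=> y; [case|split=> //; exact: JI].
  exact: Pw.
have := H w lw; rewrite /= mu_form // PIw => h.
have := HK d w (ltW d0) lw Pw; rewrite px mul0r subr0 => h2.
have : e * rdot w (C w) <= K * d * rdot w w.
  apply: le_trans (ler_norm _) _; by rewrite normrM e1 mul1r.
move=> h3; have := le_trans h h3; rewrite ler_pM2r // => h4.
by move: Kd; rewrite ltNge h4.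
Qed.

Lemma threshold_sub : threshold_set `<=` `[-1, 1]%classic.
Proof.
by rewrite threshold_grid => _ [m _ <-]; rewrite /= in_itv /= cos_geN1 cos_le1.
Qed.

Lemma mu_setE : mu_set (@Delta R) (A_kappa kappa) = `[-1, 1]%classic `\` threshold_set.
Proof.
apply/seteqP; split=> x; last first.
  by rewrite /= in_itv /= => -[x11 nx]; exact: mu_in.
move=> mx.
have x11 : -1 <= x <= 1.
  by case: mx => -[+ _]; rewrite spectrum_Delta /= in_itv.
split; first by rewrite /= in_itv.
move=> Tx; case: mx => mx.
  by apply: (mu_out (e := 1) x11 Tx) mx; rewrite normr1.
apply: (mu_out (e := -1) x11 Tx); first by rewrite normrN1.
by rewrite rmorphN1.
Qed.

Lemma thresholdsE : thresholds (@Delta R) (A_kappa kappa) = threshold_set.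
Proof.
rewrite /thresholds ess_spectrum_Delta mu_setE setDD.
by apply/setIidPr; exact: threshold_sub.
Qed.

Lemma thresholds_card : (thresholds (@Delta R) (A_kappa kappa) #= `I_kappa.+1)%card.
Proof. rewrite thresholdsE threshold_grid; apply: inj_card_eq; exact: grid_inj. Qed.

End Thresholds.

Theorem lemma3p2 (R : realType) (kappa : nat) (kappa_gt0 : (0 < kappa)%N) :
  mu_set (@Delta R) (@A_kappa R kappa) =
    `[- 1, 1]%classic `\`
      [set x : R | exists2 j : nat, (j <= kappa %/ 2)%N &
        x = cos (pi * j%:R / kappa%:R) \/ x = - cos (pi * j%:R / kappa%:R)]
  /\ (thresholds (@Delta R) (@A_kappa R kappa) #= `I_kappa.+1)%card.
Proof. by split; [exact: mu_setE|exact: thresholds_card]. Qed.
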